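(* Let $N\ge 3$, let $\Omega\subset\mathbb{R}^N$ be an exterior domain (a domain with compact complement) with Lipschitz boundary $\Gamma=\partial\Omega$, and let $A:\Omega\to\mathbb{R}^{N\times N}$ be a symmetric matrix-valued function with entries in $L^\infty(\Omega)$ for which there is $\alpha>0$ with $A(x)\xi\cdot\xi\ge\alpha^{-2}|\xi|^2$ for all $\xi\in\mathbb{R}^N$ and $x\in\Omega$. Let $f\in L^2_1(\Omega)$ and $u_0\in H^1_{-1}(\Omega)$, and let $\hat u\in \mathring{H}^1_{-1}(\Omega)+\{u_0\}$ be the unique weak solution of $-\operatorname{div}A\nabla \hat u=f$ in $\Omega$, $\hat u=u_0$ on $\Gamma$, i.e. $\langle A\nabla\hat u,\nabla u\rangle_{L^2(\Omega)}=\langle f,u\rangle_{L^2(\Omega)}$ for all $u\in\mathring{H}^1_{-1}(\Omega)$. Put $c_{N,\alpha}:=\frac{2\alpha}{N-2}$. Let $\tilde v\in L^2(\Omega)$ be an arbitrary vector field. Then $$\|\nabla\hat u-A^{-1}\tilde v\|_{L^2(\Omega),A}^2\le \mathcal{M}_+(\tilde v):=\inf_{v\in D(\Omega)}M_+^2(A^{-1}\tilde v,v)+\inf_{u\in\mathring{H}^1_{-1}(\Omega)+\{u_0\}}\tilde M_+^2(A^{-1}\tilde v,\nabla u),$$ $$\|\nabla\hat u-A^{-1}\tilde v\|_{L^2(\Omega),A}^2\ge \mathcal{M}_-(\tilde v):=\sup_{u\in\mathring{H}^1_{-1}(\Omega)}M_-(A^{-1}\tilde v,u)+\sup_{u\in\mathring{H}^1_{-1}(\Omega)+\{u_0\}}\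 \sup_{v\in D_0(\Omega)}\tilde M_-(A^{-1}\tilde v,A^{-1}v,\nabla u),$$ where $$M_+(A^{-1}\tilde v,v)=c_{N,\alpha}\|f+\operatorname{div}v\|_{L^2_1(\Omega)}+\|A^{-1}(\tilde v-v)\|_{L^2(\Omega),A},$$ $$\tilde M_+(A^{-1}\tilde v,\nabla u)=\|\nabla u-A^{-1}\tilde v\|_{L^2(\Omega),A},$$ $$M_-(A^{-1}\tilde v,u)=2\langle f,u\rangle_{L^2(\Omega)}-\langle\nabla u+2A^{-1}\tilde v,\nabla u\rangle_{L^2(\Omega),A},$$ $$\tilde M_-(A^{-1}\tilde v,A^{-1}v,\nabla u)=\langle 2\nabla u-A^{-1}(2\tilde v+v),A^{-1}v\rangle_{L^2(\Omega),A}.$$ Moreover, for every $v\in D(\Omega)$, $$M_+^2(A^{-1}\tilde v,v)\le\inf_{\beta>0}\Big(c_{N,\alpha}^2(1+1/\beta)\|f+\operatorname{div}v\|_{L^2_1(\Omega)}^2+(1+\beta)\|A^{-1}(\tilde v-v)\|_{L^2(\Omega),A}^2\Big).$$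
   Context: All functions are real-valued; the same notation is used for spaces of scalar functions and of $\mathbb{R}^N$-valued vector fields. Derivatives are weak (distributional). Weighted spaces: with $r(x)=|x|$ and $\rho=(1+r^2)^{1/2}$, for $s\in\mathbb{R}$ let $L^2_s(\Omega)=\{u:\rho^s u\in L^2(\Omega)\}$ with norm $\|u\|_{L^2_s(\Omega)}=\|\rho^s u\|_{L^2(\Omega)}$; $L^2_0(\Omega)=L^2(\Omega)$. $H^1_{-1}(\Omega)=\{u: u\in L^2_{-1}(\Omega),\ \nabla u\in L^2(\Omega)\}$ with $\|u\|_{H^1_{-1}(\Omega)}^2=\|\rho^{-1}u\|_{L^2(\Omega)}^2+\|\nabla u\|_{L^2(\Omega)}^2$. $\mathring{H}^1_{-1}(\Omega)$ is the closure of $C_c^\infty(\Omega)$ (smooth functions with compact support in $\Omega$) in $H^1_{-1}(\Omega)$; $\mathring{H}^1_{-1}(\Omega)+\{u_0\}$ is the corresponding affine space of functions $w+u_0$, $w\in\mathring{H}^1_{-1}(\Omega)$. $D(\Omega)=\{v: v\in L^2(\Omega)\text{ a vector field},\ \operatorname{div}v\in L^2_1(\Omega)\}$ and $D_0(\Omega)=\{v\in D(\Omega):\operatorname{div}v=0\}$. For vector fields $v,w\in L^2(\Omega)$: $\langle v,w\rangle_{L^2(\Omega),A}:=\langle Av,w\rangle_{L^2(\Omega)}=\int_\Omega Av\cdot w\,dx$ and $\|v\|_{L^2(\Omega),A}:=\langle v,v\rangle_{L^2(\Omega),A}^{1/2}$. The notation $\langle f,u\rangle_{L^2(\Omega)}=\int_\Omega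 fu\,dx$ is also used for $f\in L^2_1(\Omega)$, $u\in L^2_{-1}(\Omega)$ (then $fu\in L^1(\Omega)$). The existence and uniqueness of the weak solution $\hat u$ follows from the Lax–Milgram theorem together with the Poincaré-type estimate $\|u\|_{L^2_{-1}(\Omega)}\le\frac{2}{N-2}\|\nabla u\|_{L^2(\Omega)}\le c_{N,\alpha}\|\nabla u\|_{L^2(\Omega),A}$ for $u\in\mathring{H}^1_{-1}(\Omega)$. *)

(* Defs.v *)
From HB Require Import structures.
From mathcomp Require Import all_boot all_order all_algebra.
From mathcomp Require Import all_classical all_reals all_analysis.

Set Implicit Arguments.
Unset Strict Implicit.
Unset Printing Implicit Defensive.
Import Order.TTheory GRing.Theory Num.Theory.
Import numFieldNormedType.Exports.

Local Open Scope classical_set_scope.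
Local Open Scope ring_scope.

Definition rV_coord (R : realType) (n : nat) (i : 'I_n) (x : 'rV[R]_n) :
  measurableTypeR R := x 0 i.

(* The product sigma-algebra on R^n; it coincides with the Borel one. *)
Section measurable_rV.
Variables (R : realType) (n : nat).

Definition rV_cylinders : set (set 'rV[R]_n) :=
  [set B | exists i : 'I_n,
    exists2 A, measurable A & B = rV_coord i @^-1` A].

HB.instance Definition _ := @isMeasurable.Build default_measure_display
  'rV[R]_n <<s rV_cylinders >> (@sigma_algebra0 _ setT rV_cylinders)
  (@sigma_algebraC _ rV_cylinders) (@sigma_algebra_bigcup _ setT rV_cylinders).

Lemma measurable_rV_coord (i : 'I_n) :
  measurable_fun setT (rV_coord i : 'rV[R]_n -> measurableTypeR R).
Proof.
move=> _ A mA; rewrite setTI; apply: sub_sigma_algebra.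
by exists i; exists A.
Qed.

Lemma measurable_fun_rV d (T : measurableType d) (f : T -> 'rV[R]_n) :
  (forall i, measurable_fun setT (rV_coord i \o f)) ->
  measurable_fun setT f.
Proof.
move=> mf; apply: (@measurability _ _ _ _ setT f rV_cylinders) => //.
move=> _ [_ [i [A mA ->]] <-]; exact: mf.
Qed.

End measurable_rV.

Definition rV_cons (R : realType) (n : nat)
  (p : measurableTypeR R * 'rV[R]_n) : 'rV[R]_n.+1 := row_mx (p.1)%:M p.2.

Lemma measurable_rV_cons (R : realType) (n : nat) :
  measurable_fun setT (@rV_cons R n).
Proof.
apply: measurable_fun_rV => i.
case: (@split_ordP 1 n i) => j ->.
  rewrite (_ : _ \o _ = fst) //; apply/funext => p.
  by apply: etrans (row_mxEl _ _ _ _) _; rewrite ord1 mxE eqxx mulr1n.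
rewrite (_ : _ \o _ = rV_coord j \o snd).
  exact: measurableT_comp (measurable_rV_coord j) measurable_snd.
by apply/funext => p; apply: etrans (row_mxEr _ _ _ _) _.
Qed.

(* n-dimensional Lebesgue measure on the Borel sigma-algebra: the n-fold
   product of the one-dimensional one. *)
Fixpoint lebesgue_rV (R : realType) (n : nat) :
    {measure set 'rV[R]_n -> \bar R} :=
  match n with
  | 0%N => dirac (0 : 'rV[R]_0)
  | m.+1 => measure_function_pushforward__canonical__measure_function_Measure
     (lebesgue_measure \x^ lebesgue_rV R m)%E (@measurable_rV_cons R m)
  end.

Section weighted_spaces.
Context (R : realType) (N : nat).
Local Notation E := 'rV[R]_N.
Local Notation mu := (lebesgue_rV R N).
Implicit Types (Omega : set E) (u f phi : E -> R) (v w : E -> E).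

Definition dotv (x y : E) : R := \sum_i x 0 i * y 0 i.

(* The library norm on 'rV is the sup norm. *)
Definition enorm (x : E) : R := Num.sqrt (dotv x x).

Definition rho (x : E) : R := Num.sqrt (1 + enorm x ^+ 2).

(* Functions on Omega are represented by total functions whose values outside
   Omega are irrelevant, and L^2-classes by their Borel representatives. *)
Definition L2w (s : R) Omega : set (E -> R) :=
  [set u | measurable_fun Omega u /\
           mu.-integrable Omega (fun x => ((rho x `^ s * u x) ^+ 2)%:E)].

Definition L2w_norm (s : R) Omega u : R :=
  Num.sqrt (\int[mu]_(x in Omega) ((rho x `^ s * u x) ^+ 2)).

Definition L2v Omega : set (E -> E) :=
  [set v | forall i, L2w 0 Omega (fun x => v x 0 i)].

Definition L2_dot Omega f u : R := \int[mu]_(x in Omega) (f x * u x).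

Definition L2v_dot Omega v w : R := \int[mu]_(x in Omega) (dotv (v x) (w x)).

Definition L2v_norm Omega v : R := Num.sqrt (L2v_dot Omega v v).

Definition Linfty Omega : set (E -> R) :=
  [set a : E -> R | measurable_fun Omega a /\
           exists M, {ae mu, forall x, Omega x -> `|a x| <= M}].

(* The matrix-vector product "A x", with vectors encoded as rows. *)
Definition mulMv (B : 'M[R]_N) (x : E) : E := x *m B^T.

Definition mapMv (A : E -> 'M[R]_N) v : E -> E := fun x => mulMv (A x) (v x).

Definition invA (A : E -> 'M[R]_N) : E -> 'M[R]_N := fun x => invmx (A x).

Definition L2A_dot Omega (A : E -> 'M[R]_N) v w : R :=
  L2v_dot Omega (mapMv A v) w.

Definition L2A_norm Omega (A : E -> 'M[R]_N) v : R :=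
  Num.sqrt (L2A_dot Omega A v v).

Definition partial (i : 'I_N) phi : E -> R := 'D_(delta_mx 0 i) phi.

Definition iter_partial (s : seq 'I_N) phi : E -> R := foldr partial phi s.

Definition smooth phi : Prop := forall s : seq 'I_N,
  continuous (iter_partial s phi) /\
  forall i x, derivable (iter_partial s phi) x (delta_mx 0 i).

Definition supp phi : set E := closure [set x | phi x != 0].

Definition test_function Omega : set (E -> R) :=
  [set phi | [/\ smooth phi, compact (supp phi) & supp phi `<=` Omega]].

Definition grad phi : E -> E := fun x => \row_i partial i phi x.

Definition weak_gradient Omega u (du : E -> E) : Prop :=
  forall phi, test_function Omega phi -> forall i,
    L2_dot Omega u (partial i phi) = - L2_dot Omega (fun x => du x 0 i) phi.

Definition weak_divergence Omega v (dv : E -> R) : Prop :=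
  forall phi, test_function Omega phi ->
    L2v_dot Omega v (grad phi) = - L2_dot Omega dv phi.

(* Weak derivatives being determined only almost everywhere, elements of the
   spaces below are carried together with a representative of their weak
   gradient, as U = (u, grad u), or of their weak divergence, as
   V = (v, div v). *)
Definition H1w Omega : set ((E -> R) * (E -> E)) :=
  [set U | [/\ L2w (-1) Omega U.1, L2v Omega U.2 &
             weak_gradient Omega U.1 U.2]].

Definition H1w_norm Omega (U : (E -> R) * (E -> E)) : R :=
  Num.sqrt (L2w_norm (-1) Omega U.1 ^+ 2 + L2v_norm Omega U.2 ^+ 2).

Definition H1w0 Omega : set ((E -> R) * (E -> E)) :=
  [set U | H1w Omega U /\
    forall e : R, 0 < e -> exists2 phi, test_function Omega phi &
      H1w_norm Omega (U.1 \- phi, U.2 \- grad phi) < e].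

Definition H1w0_plus Omega (U0 : (E -> R) * (E -> E)) :
    set ((E -> R) * (E -> E)) :=
  [set (W.1 \+ U0.1, W.2 \+ U0.2) | W in H1w0 Omega].

Definition Hdiv Omega : set ((E -> E) * (E -> R)) :=
  [set V | [/\ L2v Omega V.1, L2w 1 Omega V.2 &
             weak_divergence Omega V.1 V.2]].

Definition Hdiv0 Omega : set (E -> E) := [set v | Hdiv Omega (v, cst 0)].

Definition exterior_domain Omega : Prop :=
  [/\ open Omega, connected Omega & compact (~` Omega)].

(* Near each boundary point, in suitable orthonormal coordinates x *m Q, the
   set Omega is the strict epigraph, in the direction of the i-th coordinate,
   of a Lipschitz function of the N - 1 others. *)
Definition lipschitz_boundary Omega : Prop :=
  forall x0, (closure Omega `\` interior Omega) x0 ->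
  exists (Q : 'M[R]_N) (i : 'I_N) (g : 'rV[R]_N.-1 -> R),
    [/\ Q *m Q^T = 1%:M, lipschitz g &
       \forall x \near x0,
         Omega x <-> g (col' i (x *m Q)) < (x *m Q) 0 i].

Definition weak_solution Omega (A : E -> 'M[R]_N) f
    (U0 U : (E -> R) * (E -> E)) : Prop :=
  H1w0_plus Omega U0 U /\
  forall W, H1w0 Omega W ->
    L2v_dot Omega (mapMv A U.2) W.2 = L2_dot Omega f W.1.

End weighted_spaces.

Section bounds.
Context (R : realType) (N : nat) (Omega : set 'rV[R]_N).
Context (A : 'rV[R]_N -> 'M[R]_N) (alpha : R) (f : 'rV[R]_N -> R).
Context (U0 : ('rV[R]_N -> R) * ('rV[R]_N -> 'rV[R]_N)).
Context (tv : 'rV[R]_N -> 'rV[R]_N).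
Local Notation E := 'rV[R]_N.

Definition poincare_cst : R := 2 * alpha / (N%:R - 2).

Definition M_plus (V : (E -> E) * (E -> R)) : R :=
  poincare_cst * L2w_norm 1 Omega (f \+ V.2) +
  L2A_norm Omega A (mapMv (invA A) (tv \- V.1)).

Definition M_plus_young (V : (E -> E) * (E -> R)) (beta : R) : R :=
  poincare_cst ^+ 2 * (1 + beta^-1) * L2w_norm 1 Omega (f \+ V.2) ^+ 2 +
  (1 + beta) * L2A_norm Omega A (mapMv (invA A) (tv \- V.1)) ^+ 2.

Definition Mt_plus (du : E -> E) : R :=
  L2A_norm Omega A (du \- mapMv (invA A) tv).

Definition M_minus (U : (E -> R) * (E -> E)) : R :=
  2 * L2_dot Omega f U.1 -
  L2A_dot Omega A (U.2 \+ 2 \*: mapMv (invA A) tv) U.2.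

Definition Mt_minus (v du : E -> E) : R :=
  L2A_dot Omega A (2 \*: du \- mapMv (invA A) (2 \*: tv \+ v))
    (mapMv (invA A) v).

Local Open Scope ereal_scope.

Definition Mcal_plus : \bar R :=
  ereal_inf [set (M_plus V ^+ 2)%R%:E | V in Hdiv Omega] +
  ereal_inf [set (Mt_plus U.2 ^+ 2)%R%:E | U in H1w0_plus Omega U0].

Definition Mcal_minus : \bar R :=
  ereal_sup [set (M_minus U)%:E | U in H1w0 Omega] +
  ereal_sup [set ereal_sup [set (Mt_minus v U.2)%:E | v in Hdiv0 Omega]
            | U in H1w0_plus Omega U0].

End bounds.

(* Main.v *)
(* With [<v, w>_A] the energy product, set [e = grad uhat - A^-1 tv].  For [w] in
   the closure of the test functions and [v] with weak divergence, testing the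
   equation for [uhat] against [w] and integrating by parts gives
     [<e, grad w>_A = <f + div v, w> - <A^-1 (tv - v), grad w>_A],
   which the weighted Poincare inequality bounds by [M_+(v) |grad w|_A].  Taking
   [w = uhat - u], the upper bound is
     [|e|^2 <= M_+^2 + |e|^2 - 2 M_+ |grad w|_A + |grad w|_A^2
            <= M_+^2 + |e - grad w|_A^2],
   so no orthogonal projection, hence no completeness, is needed.  For the lower
   bound, [M_- = 2 <e, p>_A - <p, p>_A] with [p = grad u] and
   [Mt_- = 2 <e, q>_A - <q, q>_A] with [q = A^-1 v]; as [p] and [q] are
   orthogonal, the sum is [|e|^2 - |e - p - q|^2].

   The Poincare inequality comes from integrating, for a test function [phi],
   the divergence of [phi^2 x / (1 + |x|^2)], which is at least
     [m/2 phi^2 / (1 + |x|^2) - 2/m |grad phi|^2] with [m = N - 2]. *)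
From HB Require Import structures.
Require Import Defs.
From mathcomp Require Import all_boot all_order all_algebra.
From mathcomp Require Import all_classical all_reals all_analysis.
From mathcomp Require Import measurable_realfun ring lra.
Set Implicit Arguments.
Unset Strict Implicit.
Unset Printing Implicit Defensive.
Import Order.TTheory GRing.Theory Num.Theory.
Import numFieldNormedType.Exports.

Local Open Scope classical_set_scope.
Local Open Scope ring_scope.

(** * Lebesgue measure on R^n *)

(** Second countability is what matters: an open set is the countable union of the boxes with
    rational centre and radius [1 / (k + 1)] that it contains, and each box is a finite intersection
    of coordinate preimages. *)
Lemma open_measurable_rV (R : realType) (n : nat) (O : set 'rV[R]_n) :
  open O -> measurable O.
Proof.
move=> oO.
pose box (q : 'rV[rat]_n * nat) : set 'rV[R]_n :=
  [set x | forall i, ball (ratr (q.1 0 i) : R) (q.2.+1%:R^-1) (x 0 i)].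
have mbox q : measurable (box q).
  have -> : box q = \bigcap_(i in [set: 'I_n])
      (@rV_coord R n i @^-1` ball (ratr (q.1 0 i) : R) (q.2.+1%:R^-1)).
    by apply/seteqP; split => x /= h => [i _|i]; [exact: h|exact: h i I].
  apply: fin_bigcap_measurable => [|i _]; first exact: finite_finset.
  rewrite -[X in measurable X]setTI; apply: measurable_rV_coord => //.
  apply: open_measurable; exact: ball_open.
have -> : O = \bigcup_(q in [set q | box q `<=` O]) box q.
  apply/seteqP; split=> [x Ox|x [q /= qO] /qO//].
  have /nbhs_ballP[e /= e0 eO] := open_nbhs_nbhs (conj oO Ox).
  (* Twice the radius must stay below [e]: a point of the box is within one radius of the rational
     centre, which is itself within one radius of [x]. *)
  have [k ke] : exists k : nat, k.+1%:R^-1 + k.+1%:R^-1 < e.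
    have e20 : 0 < e / 2 by rewrite divr_gt0.
    have [k _ /(_ k (leqnn k)) /= hk] := near_infty_natSinv_lt (PosNum e20).
    by exists k; rewrite [ltRHS]splitr ltrD.
  have qx i : exists q : rat, ball (ratr q : R) (k.+1%:R^-1) (x 0 i).
    have xk : x 0 i - k.+1%:R^-1 < x 0 i + k.+1%:R^-1.
      by rewrite ltrD2l gtrN// invr_gt0.
    have [q] := rat_in_itvoo xk; rewrite in_itv/= => /andP[h1 h2]; exists q.
    by rewrite /ball/= ltr_distl h1 h2.
  pose q : 'rV[rat]_n := \row_i sval (cid (qx i)).
  have xq : box (q, k) x.
    by move=> i; rewrite /= mxE; exact: (svalP (cid (qx i))).
  exists (q, k) => //= y yq; apply: eO; split => // i j.
  rewrite ord1; apply: ball_sym; apply: (@le_ball _ _ _ _ _ (ltW ke)).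
  exact: ball_triangle (ball_sym (yq j)) (xq j).
(* Countability of the index set enters through [unpickle]; a code without a box, or with a box not
   inside [O], contributes the empty set. *)
have -> : \bigcup_(q in [set q | box q `<=` O]) box q =
    \bigcup_(k : nat) (if (unpickle k : option ('rV[rat]_n * nat)) is Some q
      then (if `[<box q `<=` O>] then box q else set0) else set0).
  apply/seteqP; split=> [x [q /= qO qx]|x [k _]].
    by exists (pickle q) => //; rewrite pickleK asboolT.
  by case: unpickle => // q; case: asboolP => // qO qx; exists q.
by apply: bigcup_measurable => k _; case: unpickle => // q; case: ifP.
Qed.

Lemma continuous_measurable_rV (R : realType) (n : nat) (f : 'rV[R]_n -> R) :
  continuous f -> measurable_fun setT f.
Proof.
move=> /continuousP cf.
apply: (@measurability _ _ _ _ setT f (@RGenOpens.G R)).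
  exact: RGenOpens.measurableE.
move=> _ [_ [a [b ->] <-]]; rewrite setTI.
by apply: open_measurable_rV; apply: cf; exact: itv_open.
Qed.

(** Bounded supports are measured by cubes because the preimage of a cube under [rV_cons] is a
    product of cubes, as induction on the dimension requires. *)
Definition rV_box (R : realType) (n : nat) (M : R) : set 'rV[R]_n :=
  [set x | forall i, `|x 0 i| <= M].

Lemma rV_cons0 (R : realType) (n : nat) (p : R * 'rV[R]_n) :
  rV_cons p 0 ord0 = p.1.
Proof.
rewrite (_ : @ord0 n = @lshift 1 n ord0); last exact: val_inj.
by rewrite [LHS]row_mxEl mxE eqxx.
Qed.

Lemma rV_consS (R : realType) (n : nat) (p : R * 'rV[R]_n) i :
  rV_cons p 0 (lift ord0 i) = p.2 0 i.
Proof.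
rewrite (_ : @lift n.+1 ord0 i = @rshift 1 n i); last exact: val_inj.
by rewrite [LHS]row_mxEr.
Qed.

Lemma rV_cons_box (R : realType) (n : nat) (M : R) :
  @rV_cons R n @^-1` rV_box M = [set x | `|x| <= M] `*` rV_box M.
Proof.
apply/seteqP; split=> [p /= pM|p [/= p1 p2] i].
  split=> [|i]; first by have := pM ord0; rewrite rV_cons0.
  by have := pM (lift ord0 i); rewrite rV_consS.
by case: (unliftP ord0 i) => [j|] ->; rewrite ?rV_cons0 ?rV_consS.
Qed.

Lemma rV_box_compact (R : realType) (n : nat) (M : R) :
  compact (rV_box M : set 'rV[R]_n).
Proof.
have -> : rV_box M = [set v : 'rV[R]_n | forall i, [set` `[- M, M]] (v ord0 i)].
  by apply/seteqP; split => x /= xM i; have := xM i; rewrite in_itv/= ler_norml.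
exact: (@rV_compact _ _ (fun=> [set` `[- M, M]]) (fun=> @segment_compact _ _ _)).
Qed.

Lemma rV_box_closed (R : realType) (n : nat) (M : R) :
  closed (rV_box M : set 'rV[R]_n).
Proof. by apply: compact_closed => //; exact: rV_box_compact. Qed.

Lemma measurable_rV_box (R : realType) (n : nat) (M : R) :
  measurable (rV_box M : set 'rV[R]_n).
Proof.
rewrite -[rV_box _]setCK; apply: measurableC; apply: open_measurable_rV.
by apply: closed_openC; exact: rV_box_closed.
Qed.

Lemma measurable_normr_le (R : realType) (M : R) :
  measurable [set x : R | `|x| <= M].
Proof.
rewrite (_ : [set _ | _] = [set` `[- M, M]]); last first.
  by apply/seteqP; split => x /=; rewrite in_itv/= ler_norml.
exact: measurable_itv.
Qed.

Lemma lebesgue_normr_le_lty (R : realType) (M : R) :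
  (lebesgue_measure [set x : R | (`|x| <= M)%R] < +oo)%E.
Proof.
rewrite (_ : [set _ | _] = [set` `[- M, M]]); last first.
  by apply/seteqP; split => x /=; rewrite in_itv/= ler_norml.
by rewrite lebesgue_measure_itv/=; case: ifP => // _; rewrite -EFinB ltry.
Qed.

Lemma lebesgue_rV_box_lty (R : realType) (n : nat) (M : R) :
  (lebesgue_rV R n (rV_box M) < +oo)%E.
Proof.
elim: n => [|n IHn]; first by rewrite /= diracE ltry.
change ((lebesgue_measure \x^ lebesgue_rV R n)%E
  (@rV_cons R n @^-1` rV_box M) < +oo)%E.
rewrite rV_cons_box product_measure2E//; last 2 first.
- exact: measurable_normr_le.
- exact: measurable_rV_box.
by rewrite lte_mul_pinfty// ?ge0_fin_numE// lebesgue_normr_le_lty.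
Qed.

Lemma rV_coord_le_norm (R : realType) (n : nat) (x : 'rV[R]_n) i :
  `|x 0 i| <= `|x|.
Proof.
by rewrite [leRHS]/Num.norm/= mx_normrE; apply: le_trans (le_bigmax _ _ (0, i)).
Qed.

Lemma lebesgue_rV_sigma_finite (R : realType) (n : nat) :
  sigma_finite setT (lebesgue_rV R n).
Proof.
exists (fun k => rV_box k%:R) => [|k]; last first.
  by split; [exact: measurable_rV_box|exact: lebesgue_rV_box_lty].
apply/seteqP; split=> // x _; exists (Num.truncn `|x|).+1 => // i /=.
exact: le_trans (rV_coord_le_norm _ _) (ltW (truncnS_gt _)).
Qed.

(* An alias, because [lebesgue_rV R n] has no head constant on which to declare
   the sigma-finite structure. *)
Definition lebesgue_rV_sf (R : realType) (n : nat) : set 'rV[R]_n -> \bar R :=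
  lebesgue_rV R n.

HB.instance Definition _ (R : realType) (n : nat) :=
  Measure.copy (@lebesgue_rV_sf R n) (lebesgue_rV R n).
HB.instance Definition _ (R : realType) (n : nat) :=
  Measure_isSigmaFinite.Build _ _ _ (@lebesgue_rV_sf R n)
    (lebesgue_rV_sigma_finite R n).

Lemma rV_cons_continuousl (R : realType) (n : nat) (y : 'rV[R]_n) :
  continuous (fun t : R => rV_cons (t, y)).
Proof.
move=> t B /nbhs_ballP[e /= e0 eB]; apply/nbhs_ballP; exists e => //= s ts.
apply: eB; split=> // i j; rewrite ord1.
case: (unliftP ord0 j) => [k|] ->; rewrite ?rV_cons0 ?rV_consS//.
exact: ballxx.
Qed.

Lemma rV_cons_continuousr (R : realType) (n : nat) (t : R) :
  continuous (fun y : 'rV[R]_n => rV_cons (t, y)).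
Proof.
move=> y B /nbhs_ballP[e /= e0 eB]; apply/nbhs_ballP; exists e => //= s [_ ys].
apply: eB; split=> // i j; rewrite ord1.
case: (unliftP ord0 j) => [k|] ->; rewrite ?rV_cons0 ?rV_consS//.
exact: ballxx.
Qed.

(** Together with [rV_cons_shiftS], this identifies a partial derivative in dimension [n.+1] with a
    derivative of a slice, in the first variable or in the remaining ones. *)
Lemma rV_cons_shift0 (R : realType) (n : nat) (h t : R) (y : 'rV[R]_n) :
  rV_cons (h + t, y) = h *: delta_mx 0 ord0 + rV_cons (t, y).
Proof.
apply/rowP => j; rewrite [RHS]mxE [X in _ = X + _]mxE [X in _ * X]mxE.
case: (unliftP ord0 j) => [k|] ->.
  by rewrite !rV_consS eqxx eq_sym (negbTE (neq_lift _ _)) mulr0 add0r.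
by rewrite !rV_cons0 !eqxx mulr1.
Qed.

Lemma rV_cons_shiftS (R : realType) (n : nat) (h t : R) (y : 'rV[R]_n) i :
  rV_cons (t, h *: delta_mx 0 i + y) =
  h *: delta_mx 0 (lift ord0 i) + rV_cons (t, y).
Proof.
apply/rowP => j; rewrite [RHS]mxE [X in _ = X + _]mxE [X in _ * X]mxE.
case: (unliftP ord0 j) => [k|] ->.
  by rewrite !rV_consS !mxE eqxx (inj_eq lift_inj).
by rewrite !rV_cons0 eqxx (negbTE (neq_lift _ _)) mulr0 add0r.
Qed.

(** * Fubini's theorem and vanishing integrals of partial derivatives *)

Section fubini_rV.
Context (R : realType) (n : nat).
Implicit Types (M : R) (f : 'rV[R]_n.+1 -> R).

Lemma continuous_bounded_rV_box (m : nat) (g : 'rV[R]_m -> R) M :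
  continuous g -> exists C, forall x, rV_box M x -> `|g x| <= C.
Proof.
move=> cg.
have /compact_bounded[C [_ hC]] : compact (g @` rV_box M).
  apply: continuous_compact; last exact: rV_box_compact.
  exact: continuous_subspaceT.
exists (C + 1) => x Mx; apply: hC; last by exists x.
by rewrite ltrDl.
Qed.

(** A continuous function is bounded on the compact box, and the preimage of the box has finite
    measure. The map [phi] lets one proof serve Lebesgue measure, with the identity, and product
    measures, with [rV_cons]. *)
Lemma continuous_rV_box_integrable d (T : measurableType d)
    (mu : {measure set T -> \bar R}) (m : nat) (phi : T -> 'rV[R]_m)
    (g : 'rV[R]_m -> R) M :
  measurable_fun setT phi -> (mu (phi @^-1` rV_box M) < +oo)%E ->
  continuous g -> (forall x, ~ rV_box M x -> g x = 0) ->
  mu.-integrable setT (EFin \o (g \o phi)).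
Proof.
move=> mphi muM cg gM.
have mD : measurable (phi @^-1` rV_box M).
  by rewrite -[X in measurable X]setTI; apply: mphi => //; exact: measurable_rV_box.
have mg : measurable_fun setT (g \o phi).
  by apply: measurableT_comp => //; exact: continuous_measurable_rV.
have := @measurable_bounded_integrable _ _ _ mu (g \o phi) _ mD muM.
move=> /(_ (measurable_funTS mg)) H.
have {}H : mu.-integrable (phi @^-1` rV_box M) (EFin \o (g \o phi)).
  apply: H; have [C hC] := continuous_bounded_rV_box M cg.
  exists C; split; first exact: num_real.
  by move=> D CD x /= Mx; apply: le_trans (ltW CD); exact: hC.
move/(integrable_mkcond _ mD): H; apply: eq_integrable => // x _ /=.
rewrite patchE; case: ifPn => // /negP; rewrite inE => xM.
by rewrite gM.
Qed.

Lemma continuous_rV_box_integrableT (m : nat) (g : 'rV[R]_m -> R) M :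
  continuous g -> (forall x, ~ rV_box M x -> g x = 0) ->
  (lebesgue_rV R m).-integrable setT (EFin \o g).
Proof.
apply: (@continuous_rV_box_integrable _ _ _ _ id) => //.
exact: lebesgue_rV_box_lty.
Qed.

(** Lebesgue measure in dimension [n.+1] is a pushforward of a product, so the integral pulls back
    along [rV_cons] and Fubini applies. Both orders are kept so that the differentiated variable can
    always be handled in the inner integral. *)
Lemma integral_rV_cons f M :
  continuous f -> (forall x, ~ rV_box M x -> f x = 0) ->
  (\int[lebesgue_rV R n.+1]_x (f x)%:E =
   \int[lebesgue_measure]_t \int[lebesgue_rV R n]_y (f (rV_cons (t, y)))%:E)%E /\
  (\int[lebesgue_rV R n.+1]_x (f x)%:E =
   \int[lebesgue_rV R n]_y \int[lebesgue_measure]_t (f (rV_cons (t, y)))%:E)%E.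
Proof.
move=> cf fM.
have finM : (lebesgue_measure [set t : R | (`|t| <= M)%R] *
    @lebesgue_rV_sf R n (rV_box M) < +oo)%E.
  rewrite lte_mul_pinfty// ?ge0_fin_numE// ?lebesgue_normr_le_lty//.
  exact: lebesgue_rV_box_lty.
have i1 : (lebesgue_measure \x @lebesgue_rV_sf R n)%E.-integrable setT
    (EFin \o (f \o @rV_cons R n)).
  apply: (@continuous_rV_box_integrable _ _ _ _ _ _ M) => //.
    exact: measurable_rV_cons.
  rewrite rV_cons_box [X in (X < _)%E](product_measure1E lebesgue_measure
    (@lebesgue_rV_sf R n) (@measurable_normr_le R M)
    (@measurable_rV_box R n M)).
  exact: finM.
have i2 : (lebesgue_measure \x^ @lebesgue_rV_sf R n)%E.-integrable setT
    (EFin \o (f \o @rV_cons R n)).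
  apply: (@continuous_rV_box_integrable _ _ _ _ _ _ M) => //.
    exact: measurable_rV_cons.
  rewrite rV_cons_box [X in (X < _)%E](product_measure2E lebesgue_measure
    (@lebesgue_rV_sf R n) (@measurable_normr_le R M)
    (@measurable_rV_box R n M)).
  exact: finM.
have E : (\int[lebesgue_rV R n.+1]_x (f x)%:E =
    \int[lebesgue_measure \x^ @lebesgue_rV_sf R n]_z (f (rV_cons z))%:E)%E.
  rewrite -[LHS]/(\int[pushforward (lebesgue_measure \x^ @lebesgue_rV_sf R n)
    (@rV_cons R n)]_x (EFin \o f) x)%E.
  rewrite integral_pushforward//=.
  - exact: measurable_rV_cons.
  - by apply/measurable_EFinP; exact: continuous_measurable_rV.
by rewrite E; split; [rewrite -(integral12_prod_meas2 i1)|
  rewrite -(integral21_prod_meas2 i1)].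
Qed.

End fubini_rV.

Lemma integral_derive1_eq0 (R : realType) (F f : R -> R) (M : R) :
  (forall t, derivable F t 1) -> (forall t, 'D_1 F t = f t) -> continuous f ->
  (forall t, M < `|t| -> F t = 0) -> (forall t, M < `|t| -> f t = 0) ->
  (\int[lebesgue_measure]_t (f t)%:E = 0)%E.
Proof.
move=> dF Ff cf FM fM.
(* This [K] is positive and exceeds [M] whatever the sign of [M], so [[-K, K]] is nondegenerate and
   [F] vanishes at both of its ends. *)
pose K : R := `|M| + 1.
have MK : M < K by rewrite (le_lt_trans (ler_norm _))// ltrDl.
have K0 : 0 < K by rewrite ltr_wpDl.
have cF : continuous F.
  by move=> t; apply/differentiable_continuous/derivable1_diffP/dF.
transitivity (\int[lebesgue_measure]_(t in `[(- K)%R, K]) (f t)%:E)%E.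
  rewrite [RHS]integral_mkcond; apply: eq_integral => t _.
  rewrite patchE; case: ifPn => // /negP; rewrite inE/= in_itv/= => tK.
  rewrite fM// (lt_le_trans MK)// leNgt; apply/negP => tK'; apply: tK.
  by rewrite -ler_norml ltW.
rewrite (@continuous_FTC2 _ _ F); first 1 last.
- by rewrite gtrN.
- exact: continuous_subspaceT.
- split => [t _|| ]; first exact: dF.
  + by apply: cvg_at_right_filter; exact: cF.
  + by apply: cvg_at_left_filter; exact: cF.
- by move=> t _; rewrite derive1E Ff.
by rewrite !FM ?subee// ?normrN gtr0_norm.
Qed.

Section integral_partial.
Context (R : realType).

Lemma partial_eq0 (n : nat) (g : 'rV[R]_n -> R) (i : 'I_n) (C : set 'rV[R]_n) :
  closed C -> (forall x, ~ C x -> g x = 0) ->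
  forall x, ~ C x -> partial i g x = 0.
Proof.
move=> cC gC x xC; rewrite /partial (@near_eq_derive _ _ _ _ (cst 0)).
  exact: derive_cst.
have : nbhs x (~` C) by apply: open_nbhs_nbhs; split=> //; exact: closed_openC.
by apply: filterS => y; exact: gC.
Qed.

(** Induction on the dimension. A derivative in the first variable integrates to zero by the
    fundamental theorem of calculus in that variable; any other one acts on a slice of dimension
    [n], where the induction hypothesis applies. *)
Lemma integral_partial_eq0 (n : nat) (g : 'rV[R]_n -> R) (i : 'I_n) (M : R) :
  continuous g -> (forall x, derivable g x (delta_mx 0 i)) ->
  continuous (partial i g) -> (forall x, ~ rV_box M x -> g x = 0) ->
  (\int[lebesgue_rV R n]_x (partial i g x)%:E = 0)%E.
Proof.
elim: n => [|n IHn] in g i *; first by case: i.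
move=> cg dg cdg gM.
have dgM := partial_eq0 i (@rV_box_closed R _ M) gM.
have [I1 I2] := integral_rV_cons cdg dgM.
case: (unliftP ord0 i) => [j|] ij; rewrite {}ij in dg cdg dgM I1 I2 *.
- rewrite I1; apply: integral0_eq => t _.
  pose G y := g (rV_cons (t, y)).
  have GE y h : (G \o shift y) (h *: delta_mx 0 j) =
      (g \o shift (rV_cons (t, y))) (h *: delta_mx 0 (lift ord0 j)).
    by rewrite /G/= rV_cons_shiftS.
  have dGE y : partial j G y = partial (lift ord0 j) g (rV_cons (t, y)).
    by rewrite /partial /derive; under eq_fun do rewrite GE.
  transitivity (\int[lebesgue_rV R n]_y (partial j G y)%:E)%E.
    by apply: eq_integral => y _; rewrite dGE.
  apply: IHn.
  + by move=> y; apply: continuous_comp; [exact: rV_cons_continuousr|exact: cg].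
  + move=> y; rewrite /derivable; under eq_fun do rewrite GE.
    exact: dg.
  + rewrite (_ : partial j G = partial (lift ord0 j) g \o (fun y => rV_cons (t, y))).
      by move=> y; apply: continuous_comp; [exact: rV_cons_continuousr|exact: cdg].
    by apply/funext => y; rewrite dGE.
  + move=> y yM; apply: gM => gM; apply: yM => k.
    by have := gM (lift ord0 k); rewrite rV_consS.
- rewrite I2; apply: integral0_eq => y _.
  pose G t := g (rV_cons (t, y)).
  have GE t h : (G \o shift t) (h *: (1 : R)) =
      (g \o shift (rV_cons (t, y))) (h *: delta_mx 0 ord0).
    by rewrite /G/= -rV_cons_shift0 [h *: _]mulr1.
  have Mt t : M < `|t| -> ~ rV_box M (rV_cons (t, y)).
    by move=> Mt /(_ ord0); rewrite rV_cons0 leNgt Mt.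
  apply: (@integral_derive1_eq0 _ G _ M).
  + move=> t; rewrite /derivable; under eq_fun do rewrite GE.
    exact: dg.
  + by move=> t; rewrite /partial /derive; under eq_fun do rewrite GE.
  + by move=> t; apply: continuous_comp; [exact: rV_cons_continuousl|exact: cdg].
  + by move=> t /Mt; exact: gM.
  + by move=> t /Mt; exact: dgM.
Qed.

End integral_partial.

(** * Semi-inner products and weighted L^2 spaces *)

Section semi_inner.
Context (R : realType) (V : lmodType R).
Implicit Types (S : set V) (B : V -> V -> R) (u v w e p q : V).

(** The laws are relative to [S] because the integral of a non-integrable function is a mere default
    value. The form is only semi-definite because functions equal almost everywhere are not
    identified. *)
Definition semi_inner S B := [/\ S 0,
  forall a u v, S u -> S v -> S (a *: u + v),
  forall u v, S u -> S v -> B u v = B v u,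
  forall a u v w, S u -> S v -> S w -> B (a *: u + v) w = a * B u w + B v w &
  forall u, S u -> 0 <= B u u].

Context S B (SB : semi_inner S B).

Lemma si_memD u v : S u -> S v -> S (u + v).
Proof. by move=> Su Sv; case: SB => _ /(_ 1 u v Su Sv); rewrite scale1r. Qed.

Lemma si_memZ a u : S u -> S (a *: u).
Proof. by move=> Su; case: SB => S0 /(_ a u 0 Su S0); rewrite addr0. Qed.

Lemma si_memB u v : S u -> S v -> S (u - v).
Proof.
by move=> Su Sv; rewrite -scaleN1r; apply: si_memD => //; exact: si_memZ.
Qed.

Lemma siC u v : S u -> S v -> B u v = B v u.
Proof. by case: SB => _ _ + _ _; exact. Qed.

Lemma si_ge0 u : S u -> 0 <= B u u.
Proof. by case: SB => _ _ _ _; exact. Qed.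

Lemma siDl u v w : S u -> S v -> S w -> B (u + v) w = B u w + B v w.
Proof.
move=> Su Sv Sw; case: SB => _ _ _ /(_ 1 u v w Su Sv Sw) + _.
by rewrite scale1r mul1r.
Qed.

Lemma si0l w : S w -> B 0 w = 0.
Proof.
move=> Sw; have S0 : S 0 by case: SB.
have /eqP := siDl S0 S0 Sw; rewrite addr0 -subr_eq0 opprD addNKr oppr_eq0.
by move/eqP.
Qed.

Lemma siZl a u w : S u -> S w -> B (a *: u) w = a * B u w.
Proof.
move=> Su Sw; have S0 : S 0 by case: SB.
case: SB => _ _ _ /(_ a u 0 w Su S0 Sw) + _.
by rewrite addr0 si0l// addr0.
Qed.

Lemma siBl u v w : S u -> S v -> S w -> B (u - v) w = B u w - B v w.
Proof.
move=> Su Sv Sw; rewrite -scaleN1r siDl//; last exact: si_memZ.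
by rewrite siZl// mulN1r.
Qed.

Lemma siDr u v w : S u -> S v -> S w -> B w (u + v) = B w u + B w v.
Proof.
move=> Su Sv Sw; rewrite siC ?siDl ?(siC Sw)//; exact: si_memD.
Qed.

Lemma siZr a u w : S u -> S w -> B w (a *: u) = a * B w u.
Proof.
move=> Su Sw; rewrite siC ?siZl ?(siC Sw)//; exact: si_memZ.
Qed.

Lemma siBr u v w : S u -> S v -> S w -> B w (u - v) = B w u - B w v.
Proof.
move=> Su Sv Sw; rewrite siC ?siBl ?(siC Sw)//; exact: si_memB.
Qed.

Lemma si_CauchySchwarz u v : S u -> S v ->
  `|B u v| <= Num.sqrt (B u u) * Num.sqrt (B v v).
Proof.
move=> Su Sv; rewrite -sqrtrM ?si_ge0// -sqrtr_sqr ler_sqrt; last first.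
  by rewrite mulr_ge0 ?si_ge0.
(* Expansion of [B (t u - v) (t u - v)]; the rest is a choice of [t]. *)
have h t : 0 <= t ^+ 2 * B u u - 2 * t * B u v + B v v.
  have /si_ge0 : S (t *: u - v) by apply: si_memB => //; exact: si_memZ.
  have Stu : S (t *: u) by exact: si_memZ.
  have Sd : S (t *: u - v) by exact: si_memB.
  rewrite siBl// !siBr// !siZl// !siZr// (siC Sv Su).
  by move=> /le_trans; apply; rewrite le_eqVlt; apply/orP; left; apply/eqP; ring.
have := si_ge0 Su; rewrite le_eqVlt => /predU1P[u0|u0].
  (* If [B u u = 0], the quadratic is affine in [t]; unless [B u v = 0], this [t] brings its value
     down to [-1]. *)
  have := h ((B v v + 1) / (2 * B u v)); rewrite -u0 mulr0 add0r mul0r => h1.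
  have [->|uv0] := eqVneq (B u v) 0; first by rewrite expr0n.
  suff : (0 : R) <= -1 by rewrite ler0N1.
  apply: le_trans h1 _; rewrite (_ : _ * _ * B u v = B v v + 1).
    by rewrite opprD addrAC addNr add0r.
  by field.
(* The minimiser of the quadratic in [t]. *)
have := h (B u v / B u u) => h1.
rewrite -subr_ge0 (_ : _ - _ = B u u *
  ((B u v / B u u) ^+ 2 * B u u - 2 * (B u v / B u u) * B u v + B v v)).
  by rewrite mulr_ge0// ltW.
by field; rewrite gt_eqF.
Qed.

Lemma si_sqrtD u v : S u -> S v ->
  Num.sqrt (B (u + v) (u + v)) <= Num.sqrt (B u u) + Num.sqrt (B v v).
Proof.
move=> Su Sv; rewrite -[leRHS]ger0_norm ?addr_ge0 ?sqrtr_ge0//.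
rewrite -sqrtr_sqr ler_sqrt ?sqr_ge0// sqrrD !sqr_sqrtr ?si_ge0//.
have Sd : S (u + v) by exact: si_memD.
rewrite siDl// !siDr// (siC Sv Su).
have := le_trans (ler_norm _) (si_CauchySchwarz Su Sv).
by rewrite mulr2n; lra.
Qed.

Lemma si_sqrtB u v : S u -> S v ->
  Num.sqrt (B (u - v) (u - v)) <= Num.sqrt (B u u) + Num.sqrt (B v v).
Proof.
move=> Su Sv; have SNv := si_memZ (-1) Sv.
have := si_sqrtD Su SNv; rewrite siZl// siZr//.
by rewrite scaleN1r mulrA mulrNN mulr1 mul1r.
Qed.

(* If [B e] has norm at most [a] along [g], then
   [B (e - g) (e - g) >= B e e - 2 a |g| + |g|^2 >= B e e - a^2]. *)
Lemma si_le_sqrD e g (a : R) : S e -> S g -> B e g <= a * Num.sqrt (B g g) ->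
  B e e <= a ^+ 2 + B (e - g) (e - g).
Proof.
move=> Se Sg ag; have Sd : S (e - g) by exact: si_memB.
rewrite siBl// !siBr// (siC Sg Se).
have := sqr_sqrtr (si_ge0 Sg); have := sqr_ge0 (a - Num.sqrt (B g g)).
by rewrite sqrrB; set s := Num.sqrt _ in ag * => h1 h2; lra.
Qed.

(** By orthogonality, the right side minus the left side is [B (e - p - q) (e - p - q)]. *)
Lemma si_ge_orthogonal e p q : S e -> S p -> S q -> B p q = 0 ->
  (2 * B e p - B p p) + (2 * B e q - B q q) <= B e e.
Proof.
move=> Se Sp Sq pq; have Spq : S (p + q) by exact: si_memD.
have Sd : S (e - (p + q)) by exact: si_memB.
have := si_ge0 Sd; rewrite siBl// !siBr// !(siDl Sp Sq)// !(siDr Sp Sq)//.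
by rewrite (siC Sq Sp) pq (siC Sp Se) (siC Sq Se); lra.
Qed.

End semi_inner.

(** * Square-integrable functions with a general weight *)

Section weighted_L2.
Context d (T : measurableType d) (R : realType) (mu : {measure set T -> \bar R}).
Context (D : set T) (mD : measurable D) (k : T -> R) (mk : measurable_fun D k).
Implicit Types u v : T -> R.

(** The weight is left general: [rho x ^ s] gives [L2w s], and the constant [1] serves the duality
    pairing once the weights have been absorbed into the functions. *)
Definition wL2 : set (T -> R) :=
  [set u | measurable_fun D u /\
           mu.-integrable D (fun x => ((k x * u x) ^+ 2)%:E)].

Definition wdot u v : R := \int[mu]_(x in D) ((k x * u x) * (k x * v x)).

Lemma wL2_measurable u : wL2 u -> measurable_fun D (fun x => k x * u x).
Proof. by case=> mu_ _; exact: measurable_funM. Qed.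

Lemma wL2M_integrable u v : wL2 u -> wL2 v ->
  mu.-integrable D (EFin \o (fun x => (k x * u x) * (k x * v x))).
Proof.
move=> Lu Lv.
have iD := @integrableD _ _ _ mu _ mD _ _ (proj2 Lu) (proj2 Lv).
apply: le_integrable iD => //.
  by apply/measurable_EFinP; apply: measurable_funM; exact: wL2_measurable.
move=> x Dx /=; rewrite lee_fin [leRHS]ger0_norm; last first.
  by rewrite addr_ge0// sqr_ge0.
rewrite ler_norml; move: (k x * u x) (k x * v x) => a b.
have := sqr_ge0 (a - b); have := sqr_ge0 (a + b).
have := sqr_ge0 a; have := sqr_ge0 b; rewrite sqrrB sqrrD => *.
by apply/andP; split; lra.
Qed.

Lemma wL2_semi_inner : semi_inner wL2 wdot.
Proof.
split.
- split; first exact: measurable_cst.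
  rewrite (_ : (fun _ => _) = cst 0%E); first exact: integrable0.
  by apply/funext => x /=; rewrite mulr0 expr0n.
- move=> a u v Lu Lv; split.
    by apply: measurable_funD; [apply: measurable_funM|]; [|case: Lu|case: Lv].
  (* The dominating function comes from [(a y + z)^2 <= 2 a^2 y^2 + 2 z^2]. *)
  have iD := @integrableD _ _ _ mu _ mD _ _
    (integrableZl mD (2 * a ^+ 2) (proj2 Lu)) (integrableZl mD 2 (proj2 Lv)).
  apply: le_integrable iD => //.
    apply/measurable_EFinP; apply: measurable_funX; apply: measurable_funM => //.
    by apply: measurable_funD; [apply: measurable_funM|]; [|case: Lu|case: Lv].
  move=> x Dx /=; rewrite lee_fin.
  rewrite (ger0_norm (sqr_ge0 _)); apply: le_trans (ler_norm _).
  have -> : k x * (a *: u + v) x = a * (k x * u x) + k x * v x.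
    by rewrite -[(a *: u + v) x]/(a * u x + v x); ring.
  by have := sqr_ge0 (a * (k x * u x) - k x * v x); lra.
- by move=> u v _ _; apply: eq_Rintegral => x _; rewrite mulrC.
- move=> a u v w Lu Lv Lw; rewrite -RintegralZl//; last exact: wL2M_integrable.
  rewrite -RintegralD//; last exact: wL2M_integrable.
    apply: eq_Rintegral => x _; rewrite -[(a *: u + v) x]/(a * u x + v x).
    by ring.
  exact: (integrableZl mD a (wL2M_integrable Lu Lw)).
- by move=> u Lu; apply: Rintegral_ge0 => x _; rewrite -expr2 sqr_ge0.
Qed.

End weighted_L2.

Section rho.
Context (R : realType) (N : nat).
Implicit Types x : 'rV[R]_N.

Lemma dotv_ge0 x : 0 <= dotv x x.
Proof. by apply: sumr_ge0 => i _; rewrite -expr2 sqr_ge0. Qed.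

Lemma sqr_enorm x : enorm x ^+ 2 = dotv x x.
Proof. by rewrite sqr_sqrtr// dotv_ge0. Qed.

Lemma sqr_rho x : rho x ^+ 2 = 1 + dotv x x.
Proof. by rewrite sqr_sqrtr sqr_enorm// addr_ge0// dotv_ge0. Qed.

Lemma rho_ge1 x : 1 <= rho x.
Proof.
rewrite -sqrtr1 ler_sqrt; first by rewrite lerDl sqr_ge0.
by rewrite addr_ge0// sqr_ge0.
Qed.

Lemma rho_gt0 x : 0 < rho x.
Proof. by apply: lt_le_trans (rho_ge1 x). Qed.

Lemma continuous_dotv : continuous (fun x : 'rV[R]_N => dotv x x).
Proof.
rewrite /dotv; apply: (@continuous_big _ _ _ _ xpredT) => [|i _].
  exact: add_continuous.
by move=> x; apply: continuousM; exact: coord_continuous.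
Qed.

Lemma continuous_rho : continuous (@rho R N).
Proof.
have -> : @rho R N = Num.sqrt \o (fun x => 1 + dotv x x).
  by apply/funext => x; rewrite /rho sqr_enorm.
move=> x; apply: continuous_comp; last exact: sqrt_continuous.
by apply: continuousD; [exact: cst_continuous|exact: continuous_dotv].
Qed.

Lemma measurable_rho_powR (s : R) (D : set 'rV[R]_N) :
  measurable_fun D (fun x => rho x `^ s).
Proof.
apply: measurable_funTS.
have mr := continuous_measurable_rV (@continuous_rho).
exact: (measurableT_comp (@measurable_powR R s) mr).
Qed.

Lemma rho_powR_le1 (s : R) x : s <= 0 -> rho x `^ s <= 1.
Proof. by move=> s0; rewrite -[leRHS](powRr0 (rho x)) ler_powR// rho_ge1. Qed.

End rho.

(** * The concrete spaces on Omega and their duality pairing *)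

Section L2_spaces.
Context (R : realType) (N : nat) (Omega : set 'rV[R]_N).
Hypothesis mO : measurable Omega.
Local Notation E := 'rV[R]_N.
Local Notation mu := (lebesgue_rV R N).
Implicit Types (u f g : E -> R) (v w : E -> E) (s : R).

Lemma L2w_semi_inner s :
  semi_inner (L2w s Omega) (wdot mu Omega (fun x => rho x `^ s)).
Proof.
exact: (@wL2_semi_inner _ _ _ mu _ mO _ (@measurable_rho_powR R N s Omega)).
Qed.

Lemma L2w_normE s u :
  L2w_norm s Omega u = Num.sqrt (wdot mu Omega (fun x => rho x `^ s) u u).
Proof. by []. Qed.

Lemma L2w0M_integrable f g : L2w 0 Omega f -> L2w 0 Omega g ->
  mu.-integrable Omega (EFin \o (fun x => f x * g x)).
Proof.
move=> Lf Lg.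
have := wL2M_integrable mO (@measurable_rho_powR R N 0 Omega) Lf Lg.
by under eq_fun do rewrite !powRr0 !mul1r.
Qed.

Lemma L2v_dot_integrable v w : L2v Omega v -> L2v Omega w ->
  mu.-integrable Omega (EFin \o (fun x => dotv (v x) (w x))).
Proof.
move=> Lv Lw; rewrite /dotv /comp; under eq_fun do rewrite -sumEFin.
by apply: integrable_sum => // i _; exact: L2w0M_integrable.
Qed.

Lemma L2v_semi_inner : semi_inner (L2v Omega) (L2v_dot Omega).
Proof.
have S0 := L2w_semi_inner 0; split.
- move=> i; rewrite (_ : (fun _ => _) = 0); first by case: S0.
  by apply/funext => x; rewrite mxE.
- move=> a v w Lv Lw i.
  rewrite (_ : (fun _ => _) = a *: (fun x => v x 0 i) + (fun x => w x 0 i)).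
    by case: S0 => _ + _ _ _; apply; [exact: Lv|exact: Lw].
  by apply/funext => x; rewrite !mxE.
- move=> v w _ _; apply: eq_Rintegral => x _.
  by apply: eq_bigr => i _; rewrite mulrC.
- move=> a v v' w Lv Lv' Lw; rewrite -RintegralZl//; last exact: L2v_dot_integrable.
  rewrite -RintegralD//; last exact: L2v_dot_integrable.
    apply: eq_Rintegral => x _; rewrite mulr_sumr -big_split; apply: eq_bigr => i _.
    by rewrite -[(a *: v + v') x]/(a *: v x + v' x) !mxE/= mulrDl mulrA.
  exact: (integrableZl mO a (L2v_dot_integrable Lv Lw)).
- by move=> v _; apply: Rintegral_ge0 => x _; exact: dotv_ge0.
Qed.

Lemma rho_powRK (x : E) (a b : R) : (rho x `^ 1 * a) * (rho x `^ (-1) * b) = a * b.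
Proof.
rewrite powRr1 ?powR_inv1 ?(ltW (rho_gt0 x))// mulrACA mulfV ?mul1r//.
by rewrite gt_eqF// rho_gt0.
Qed.

Lemma L2w_pairing_wL2 s u : L2w s Omega u ->
  wL2 mu Omega (cst 1) (fun x => rho x `^ s * u x).
Proof.
move=> [mf_ If]; split.
  by apply: measurable_funM => //; exact: measurable_rho_powR.
by under eq_fun do rewrite mul1r.
Qed.

Lemma L2_dot_integrable f u : L2w 1 Omega f -> L2w (-1) Omega u ->
  mu.-integrable Omega (EFin \o (fun x => f x * u x)).
Proof.
move=> /L2w_pairing_wL2 Lf /L2w_pairing_wL2 Lu.
have := wL2M_integrable mO (measurable_cst _) Lf Lu.
by under eq_fun do rewrite !mul1r rho_powRK.
Qed.

(** The weights [rho] and [rho^-1] cancel in the product, so this is Cauchy-Schwarz in plain [L^2]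
    for [rho f] and [rho^-1 u]. *)
Lemma L2_dot_le f u : L2w 1 Omega f -> L2w (-1) Omega u ->
  `|L2_dot Omega f u| <= L2w_norm 1 Omega f * L2w_norm (-1) Omega u.
Proof.
move=> /L2w_pairing_wL2 Lf /L2w_pairing_wL2 Lu.
have := si_CauchySchwarz (wL2_semi_inner mu mO (measurable_cst _)) Lf Lu.
rewrite /wdot; under eq_Rintegral do rewrite !mul1r rho_powRK.
under [X in _ <= Num.sqrt X * _]eq_Rintegral do rewrite !mul1r.
by under [X in _ <= _ * Num.sqrt X]eq_Rintegral do rewrite !mul1r.
Qed.

Lemma L2_dotDl f g u : L2w 1 Omega f -> L2w 1 Omega g -> L2w (-1) Omega u ->
  L2_dot Omega (f \+ g) u = L2_dot Omega f u + L2_dot Omega g u.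
Proof.
move=> Lf Lg Lu; rewrite /L2_dot -RintegralD ?L2_dot_integrable//.
by apply: eq_Rintegral => x _; rewrite mulrDl.
Qed.

Lemma L2_dotBr f u g : L2w 1 Omega f -> L2w (-1) Omega u -> L2w (-1) Omega g ->
  L2_dot Omega f (u \- g) = L2_dot Omega f u - L2_dot Omega f g.
Proof.
move=> Lf Lu Lg; rewrite /L2_dot -RintegralB ?L2_dot_integrable//.
by apply: eq_Rintegral => x _; rewrite mulrBr.
Qed.

Lemma Linfty_mul_L2 a u : Linfty Omega a -> L2w 0 Omega u ->
  L2w 0 Omega (fun x => a x * u x).
Proof.
move=> [ma [M aM]] [mu_ iu]; split; first exact: measurable_funM.
have mau s : measurable_fun Omega (fun x => (rho x `^ s * (a x * u x)) ^+ 2).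
  apply: measurable_funX; apply: measurable_funM; first exact: measurable_rho_powR.
  exact: measurable_funM.
apply/integrableP; split; first exact/measurable_EFinP.
have iMu := integrableZl mO (M ^+ 2) iu.
move/integrableP : (iMu) => [mMu]; apply: le_lt_trans.
(* The bound by [M] holds only almost everywhere, so the integrals are compared instead of
   dominating pointwise. *)
apply: ae_ge0_le_integral => //.
- by apply: measurableT_comp => //; exact/measurable_EFinP.
- exact: measurableT_comp.
apply: filterS aM => x aM Ox /=; rewrite lee_fin !powRr0 !mul1r exprMn normrM.
rewrite [leRHS]normrM ler_wpM2r// !ger0_norm ?sqr_ge0//.
rewrite -[leLHS]real_normK ?num_real// lerXn2r// ?nnegrE ?aM//.
exact: le_trans (aM Ox).
Qed.

Lemma mapMv_L2 (B : E -> 'M[R]_N) v :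
  (forall i j, Linfty Omega (fun x => B x i j)) -> L2v Omega v ->
  L2v Omega (mapMv B v).
Proof.
move=> LB Lv i; have S0 := L2w_semi_inner 0.
rewrite (_ : (fun _ => _) = \sum_j (fun x => B x i j * v x 0 j)).
  elim/big_ind: _ => [|f g|j _]; first by case: S0.
    exact: (si_memD S0).
  exact: Linfty_mul_L2.
apply/funext => x; rewrite fct_sumE [LHS]mxE; apply: eq_bigr => j _.
by rewrite mxE mulrC.
Qed.

End L2_spaces.

(** * Elliptic matrix fields *)

Section dotv_mulMv.
Context (R : realType) (N : nat).
Implicit Types (x y : 'rV[R]_N) (B : 'M[R]_N).

Lemma dotvE x y : dotv x y = (x *m y^T) 0 0.
Proof. by rewrite mxE; apply: eq_bigr => i _; rewrite mxE. Qed.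

Lemma dotv_mulMv B x y : dotv (mulMv B x) y = dotv x (mulMv B^T y).
Proof. by rewrite !dotvE trmx_mul !trmxK mulmxA. Qed.

Lemma dotv_semi_inner : semi_inner setT (@dotv R N).
Proof.
split => //.
- by move=> x y _ _; apply: eq_bigr => i _; rewrite mulrC.
- by move=> a x y z _ _ _; rewrite !dotvE mulmxDl -scalemxAl !mxE.
- by move=> x _; exact: dotv_ge0.
Qed.

Lemma sqr_coord_le_dotv x i : x 0 i ^+ 2 <= dotv x x.
Proof.
rewrite /dotv (bigD1 i)//= -expr2 lerDl sumr_ge0// => j _.
by rewrite -expr2 sqr_ge0.
Qed.

Lemma dotv_eq0 x : dotv x x = 0 -> x = 0.
Proof.
move=> x0; apply/rowP => i; rewrite mxE; apply/eqP; rewrite -sqrf_eq0.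
by rewrite eq_le sqr_ge0 -x0 sqr_coord_le_dotv.
Qed.

Section elliptic.
Context (B : 'M[R]_N) (a : R) (a_gt0 : 0 < a).
Hypothesis B_ell : forall x, a * dotv x x <= dotv (mulMv B x) x.

(** Expanding [|B x - a x|^2 >= 0] gives [|B x|^2 >= 2 a (B x . x) - a^2 |x|^2], and ellipticity
    bounds the first term below by [2 a^2 |x|^2]. *)
Lemma elliptic_dotv_le x : a ^+ 2 * dotv x x <= dotv (mulMv B x) (mulMv B x).
Proof.
have S := dotv_semi_inner.
have := si_ge0 S (I : setT (mulMv B x - a *: x)).
rewrite (siBl S)// !(siBr S)// !(siZl S)// !(siZr S)// (siC S (u := x))//.
have := ler_wpM2l (ltW a_gt0) (B_ell x).
by rewrite mulrA -expr2; lra.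
Qed.

Lemma elliptic_unitmx : B \in unitmx.
Proof.
rewrite -unitmx_tr -row_free_unit; apply: inj_row_free => x xB.
apply: dotv_eq0; apply/eqP; rewrite eq_le dotv_ge0 andbT.
rewrite -(pmulr_rle0 _ a_gt0) (le_trans (B_ell x))// /mulMv xB.
by rewrite /dotv big1// => i _; rewrite mxE mul0r.
Qed.

Lemma elliptic_mulMvK x : mulMv B (mulMv (invmx B) x) = x.
Proof.
by rewrite /mulMv -mulmxA -trmx_mul mulmxV ?elliptic_unitmx// trmx1 mulmx1.
Qed.

Lemma elliptic_invmx_le i j : `|invmx B i j| <= a^-1.
Proof.
have -> : invmx B i j = mulMv (invmx B) (delta_mx 0 j) 0 i.
  rewrite mxE (bigD1 j)//= big1 ?addr0 => [|k kj]; rewrite !mxE eqxx/=.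
    by rewrite eqxx mul1r.
  by rewrite (negbTE kj) mul0r.
(* Here [x] is the [j]-th column of the inverse, so [B x] is a unit vector and the previous bound
   reads [a^2 |x|^2 <= 1]. *)
set x := mulMv _ _; have := elliptic_dotv_le x; rewrite elliptic_mulMvK.
have -> : dotv (delta_mx 0 j) (delta_mx 0 j) = 1 :> R.
  rewrite /dotv (bigD1 j)//= big1 ?addr0 => [|k kj]; rewrite !mxE eqxx/=.
    by rewrite eqxx mul1r.
  by rewrite (negbTE kj) mul0r.
move=> h; rewrite -ler_sqr ?nnegrE ?invr_ge0 ?(ltW a_gt0)//.
rewrite real_normK ?num_real// exprVn.
rewrite -(ler_pM2l (exprn_gt0 2 a_gt0)) mulfV ?expf_neq0 ?gt_eqF//.
by apply: le_trans h; rewrite ler_wpM2l ?sqr_ge0// sqr_coord_le_dotv.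
Qed.

End elliptic.
End dotv_mulMv.

Lemma measurable_fun_inv d (T : measurableType d) (R : realType) (D : set T)
  (f : T -> R) : measurable_fun D f -> measurable_fun D (fun x => (f x)^-1).
Proof.
move=> mf.
(* Squaring makes the base nonnegative, where [powR] with exponent [-1] is the inverse. At a zero of
   [f] both sides are [0]. *)
have -> : (fun x => (f x)^-1) = (fun x => f x * (f x ^+ 2) `^ (-1)).
  apply/funext => x; rewrite powR_inv1 ?sqr_ge0//.
  have [->|f0] := eqVneq (f x) 0; first by rewrite invr0 mul0r.
  by field.
apply: measurable_funM => //.
exact: (measurableT_comp (@measurable_powR R (-1)) (measurable_funX 2 mf)).
Qed.

Lemma measurable_fun_det d (T : measurableType d) (R : realType) (D : set T)
    (n : nat) (M : T -> 'M[R]_n) :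
  (forall i j, measurable_fun D (fun x => M x i j)) ->
  measurable_fun D (fun x => \det (M x)).
Proof.
move=> mM; apply: measurable_sum => s; apply: measurable_funM => //.
by apply: measurable_prod => i _; exact: mM.
Qed.

Section elliptic_matrix_field.
Context (R : realType) (N : nat) (Omega : set 'rV[R]_N) (A : 'rV[R]_N -> 'M[R]_N).
Context (alpha : R).
Hypotheses (mO : measurable Omega)
  (A_sym : forall x, Omega x -> (A x)^T = A x)
  (A_bnd : forall i j, Linfty Omega (fun x => A x i j))
  (alpha_gt0 : 0 < alpha)
  (A_ell : forall x, Omega x -> forall xi : 'rV[R]_N,
     alpha ^- 2 * enorm xi ^+ 2 <= dotv (mulMv (A x) xi) xi).
Local Notation E := 'rV[R]_N.
Implicit Types v w : E -> E.

Let a_gt0 : 0 < alpha ^- 2. Proof. by rewrite invr_gt0 exprn_gt0. Qed.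

Let A_ell' x : Omega x ->
  forall xi, alpha ^- 2 * dotv xi xi <= dotv (mulMv (A x) xi) xi.
Proof. by move=> Ox xi; rewrite -sqr_enorm A_ell. Qed.

(** Ellipticity bounds the entries of the inverse uniformly; Cramer's rule, valid on [Omega] where
    [A] is invertible, makes them measurable. *)
Lemma invA_Linfty i j : Linfty Omega (fun x => invA A x i j).
Proof.
split; last first.
  exists (alpha ^- 2)^-1; apply: nearW => x Ox.
  exact: elliptic_invmx_le (A_ell' Ox) _ _.
have mA k l : measurable_fun Omega (fun x => A x k l) by case: (A_bnd k l).
apply: (@eq_measurable_fun _ _ _ _ _
    (fun x => (\det (A x))^-1 * cofactor (A x) j i)).
  move=> x; rewrite inE => Ox; rewrite /invA /invmx.
  by rewrite (elliptic_unitmx a_gt0 (A_ell' Ox)) !mxE.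
apply: measurable_funM; first exact/measurable_fun_inv/measurable_fun_det.
apply: measurable_funM => //; apply: measurable_fun_det => k l.
by under eq_fun do rewrite !mxE; exact: mA.
Qed.

Lemma L2v_mapA v : L2v Omega v -> L2v Omega (mapMv A v).
Proof. exact: mapMv_L2. Qed.

Lemma L2v_mapinvA v : L2v Omega v -> L2v Omega (mapMv (invA A) v).
Proof. by apply: mapMv_L2 => // i j; exact: invA_Linfty. Qed.

Lemma L2A_dot_invA v w :
  L2A_dot Omega A (mapMv (invA A) v) w = L2v_dot Omega v w.
Proof.
apply: eq_Rintegral => x; rewrite inE => Ox.
by rewrite /mapMv (elliptic_mulMvK a_gt0 (A_ell' Ox)).
Qed.

Lemma L2A_semi_inner : semi_inner (L2v Omega) (L2A_dot Omega A).
Proof.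
have S := L2v_semi_inner mO; split.
- by case: S.
- by case: S.
- move=> v w _ _; apply: eq_Rintegral => x; rewrite inE => Ox.
  by rewrite dotv_mulMv A_sym// (siC (dotv_semi_inner R N)).
- move=> a v v' w Lv Lv' Lw; rewrite /L2A_dot.
  have -> : mapMv A (a *: v + v') = a *: mapMv A v + mapMv A v'.
    by apply/funext => x; rewrite /mapMv /mulMv mulmxDl -scalemxAl.
  by case: S => _ _ _ + _; apply => //; exact: L2v_mapA.
- move=> v _; apply: Rintegral_ge0 => x Ox; apply: le_trans (A_ell Ox _).
  by rewrite mulr_ge0 ?sqr_ge0// ltW.
Qed.

Lemma L2v_norm_le_L2A_norm v : L2v Omega v ->
  L2v_norm Omega v <= alpha * L2A_norm Omega A v.
Proof.
move=> Lv.
have h : L2v_dot Omega v v <= alpha ^+ 2 * L2A_dot Omega A v v.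
  have iAv := L2v_dot_integrable mO (L2v_mapA Lv) Lv.
  rewrite /L2A_dot {2}/L2v_dot -RintegralZl//; apply: le_Rintegral => //.
  - exact: L2v_dot_integrable.
  - exact: (integrableZl mO _ iAv).
  move=> x Ox; have := A_ell' Ox (v x).
  by rewrite -ler_pdivlMl ?invr_gt0 ?exprn_gt0// invrK.
apply: le_trans (ler_wsqrtr h) _.
by rewrite sqrtrM ?sqr_ge0// sqrtr_sqr ger0_norm// ltW.
Qed.

End elliptic_matrix_field.

(** * The Hardy inequality *)

Section hardy_field.
Context (R : realType) (N : nat).
Local Notation E := 'rV[R]_N.
Implicit Types (x : E) (i j : 'I_N) (phi : E -> R).

Lemma is_derive_coord x i j :
  is_derive x (delta_mx 0 i) (fun y : E => y 0 j) (i == j)%:R.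
Proof.
have h : (fun h : R => h^-1 *: (((fun y : E => y 0 j) \o shift x)
    (h *: delta_mx 0 i) - x 0 j)) @ 0^' --> ((i == j)%:R : R).
  apply: cvg_near_cst; near=> t.
  have t0 : t != 0 by near: t; exact: nbhs_dnbhs_neq.
  by rewrite /= !mxE eqxx/= addrK eq_sym scalerA mulVf// scale1r.
by apply: DeriveDef; [exact: cvgP h|exact: cvg_lim h].
Unshelve. all: by end_near. Qed.

Lemma is_derive_dotv x i :
  is_derive x (delta_mx 0 i) (fun y : E => dotv y y) (2 * x 0 i).
Proof.
have h := is_derive_sum (fun j => is_deriveM (is_derive_coord x i j)
  (is_derive_coord x i j)).
rewrite (_ : (fun _ => _) =
    \sum_(j < N) (fun y : E => y 0 j) * (fun y : E => y 0 j)); last first.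
  by apply/funext => y; rewrite fct_sumE.
apply: is_derive_eq h _; rewrite (bigD1 i)//= big1 => [|j ji].
  by rewrite eqxx addr0 mulr_natl mulr2n; congr (_ + _); exact: mulr1.
by rewrite eq_sym (negbTE ji) scaler0 addr0.
Qed.

(** The [i]-th component of [phi^2 x / (1 + |x|^2)]; the added [1] matches the weight [rho^-2] and
    avoids a singularity at the origin. *)
Definition hardy_field phi i x : R := x 0 i * (1 + dotv x x)^-1 * phi x ^+ 2.

Lemma is_derive_hardy_field phi i x : derivable phi x (delta_mx 0 i) ->
  is_derive x (delta_mx 0 i) (hardy_field phi i)
    ((1 + dotv x x)^-1 * phi x ^+ 2 -
     2 * (x 0 i ^+ 2 * (1 + dotv x x)^-1 ^+ 2 * phi x ^+ 2) +
     2 * (1 + dotv x x)^-1 * phi x * (x 0 i * partial i phi x)).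
Proof.
move=> dphi; have q0 : 1 + dotv x x != 0 by rewrite gt_eqF// ltr_wpDr ?dotv_ge0.
have dq : is_derive x (delta_mx 0 i) (fun y : E => 1 + dotv y y) (2 * x 0 i).
  have := is_deriveD (is_derive_cst (1 : R) x (delta_mx 0 i)) (is_derive_dotv x i).
  by rewrite add0r.
have dV : is_derive x (delta_mx 0 i) (fun y : E => (1 + dotv y y)^-1)
    (- (1 + dotv x x) ^- 2 * (2 * x 0 i)).
  apply: DeriveDef; first by apply: derivableV => //; exact: ex_derive.
  by rewrite deriveV// derive_val.
have dphi' : is_derive x (delta_mx 0 i) phi (partial i phi x).
  exact: derivableP.
have := is_deriveM (is_deriveM (is_derive_coord x i i) dV) (is_deriveM dphi' dphi').
rewrite eqxx => h; apply: is_derive_eq h _.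
rewrite /GRing.scale/= -[(_ * _ : E -> R) x]/(_ * _).
rewrite -exprVn; move: (1 + dotv x x)^-1 => r.
by rewrite -[(phi * phi) x]/(phi x * phi x); ring.
Qed.

Let contM (f g : E -> R) : continuous f -> continuous g ->
  continuous (fun x => f x * g x).
Proof. by move=> cf cg x; apply: continuousM; [exact: cf|exact: cg]. Qed.

Let contD (f g : E -> R) : continuous f -> continuous g ->
  continuous (fun x => f x + g x).
Proof. by move=> cf cg x; apply: continuousD; [exact: cf|exact: cg]. Qed.

Let contB (f g : E -> R) : continuous f -> continuous g ->
  continuous (fun x => f x - g x).
Proof. by move=> cf cg x; apply: continuousB; [exact: cf|exact: cg]. Qed.

Let contX (f : E -> R) n : continuous f -> continuous (fun x => f x ^+ n).
Proof.
move=> cf x; apply: (@continuous_comp _ _ _ f (fun y : R => y ^+ n)).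
  exact: cf.
exact: exprn_continuous.
Qed.

Let contq : continuous (fun x : E => (1 + dotv x x)^-1).
Proof.
move=> x; apply: (@continuousV _ _ (fun x : E => 1 + dotv x x));
  first by rewrite gt_eqF// ltr_wpDr ?dotv_ge0.
by apply: continuousD; [exact: cst_continuous|exact: continuous_dotv].
Qed.

Let contx i : continuous (fun x : E => x 0 i).
Proof. exact: coord_continuous. Qed.

Lemma continuous_hardy_field phi i : continuous phi ->
  continuous (hardy_field phi i).
Proof. by move=> cphi; apply: contM; [exact: contM|exact: contX]. Qed.

Lemma continuous_partial_hardy_field phi i : continuous phi ->
  (forall x, derivable phi x (delta_mx 0 i)) -> continuous (partial i phi) ->
  continuous (partial i (hardy_field phi i)).
Proof.
move=> cphi dphi cdphi.
rewrite (_ : partial i _ = fun x => (1 + dotv x x)^-1 * phi x ^+ 2 -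
     2 * (x 0 i ^+ 2 * (1 + dotv x x)^-1 ^+ 2 * phi x ^+ 2) +
     2 * (1 + dotv x x)^-1 * phi x * (x 0 i * partial i phi x)); last first.
  apply/funext => x.
  exact: (@derive_val _ _ _ _ _ _ _ (is_derive_hardy_field (dphi x))).
have c2 : continuous (fun _ : E => 2 : R) by move=> x; exact: cst_continuous.
apply: contD; [apply: contB|].
- by apply: contM => //; exact: contX.
- by apply: contM => //; apply: contM; [apply: contM|]; exact: contX.
- by apply: contM; [apply: contM; [exact: contM|exact: cphi]|exact: contM].
Qed.

End hardy_field.

(** * Test functions and the pointwise Hardy estimate *)

Section test_functions.
Context (R : realType) (N : nat) (Omega : set 'rV[R]_N).
Local Notation E := 'rV[R]_N.
Local Notation mu := (lebesgue_rV R N).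
Implicit Types (phi : E -> R) (D : set E).

Lemma test_continuous phi : test_function Omega phi -> continuous phi.
Proof. by case=> /(_ [::])[]. Qed.

Lemma test_derivable phi i x : test_function Omega phi ->
  derivable phi x (delta_mx 0 i).
Proof. by case=> /(_ [::])[_]. Qed.

Lemma test_partial_continuous phi i : test_function Omega phi ->
  continuous (partial i phi).
Proof. by case=> /(_ [:: i])[]. Qed.

Lemma test_eq0 phi x : ~ supp phi x -> phi x = 0.
Proof.
move=> xphi; apply/eqP/negPn/negP => phix; apply: xphi.
exact: subset_closure.
Qed.

Lemma test_partial_eq0 phi i x : ~ supp phi x -> partial i phi x = 0.
Proof.
apply: (partial_eq0 i (C := supp phi)) => [|y]; first exact: closed_closure.
exact: test_eq0.
Qed.

Lemma test_supp_box phi : test_function Omega phi ->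
  exists M, supp phi `<=` rV_box M.
Proof.
case=> _ /compact_bounded[M [_ hM]] _; exists (M + 1) => x xphi i.
by apply: le_trans (rV_coord_le_norm _ _) _; apply: hM => //; rewrite ltrDl.
Qed.

(** For [s <= 0] the weight is at most [1], so the unweighted square, continuous and zero off a box,
    dominates. *)
Lemma L2w_continuous_rV_box D s (g : E -> R) M : measurable D -> s <= 0 ->
  continuous g -> (forall x, ~ rV_box M x -> g x = 0) -> L2w s D g.
Proof.
move=> mD s0 cg gM; split.
  by apply: measurable_funTS; exact: continuous_measurable_rV.
have ig2 : mu.-integrable D (EFin \o (fun x => g x ^+ 2)).
  apply: integrableS (continuous_rV_box_integrableT (M := M) _ _) => //.
    by move=> x; apply: continuousM; exact: cg.
  by move=> x /gM ->; rewrite expr0n.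
apply: le_integrable ig2 => //.
  apply/measurable_EFinP; apply: measurable_funX; apply: measurable_funM.
    exact: measurable_rho_powR.
  by apply: measurable_funTS; exact: continuous_measurable_rV.
move=> x Dx /=; rewrite lee_fin !ger0_norm ?sqr_ge0// exprMn.
by rewrite ler_piMl ?sqr_ge0// expr_le1// ?powR_ge0// rho_powR_le1.
Qed.

Lemma test_L2w D s phi : measurable D -> s <= 0 -> test_function Omega phi ->
  L2w s D phi.
Proof.
move=> mD s0 tphi; have [M hM] := test_supp_box tphi.
apply: (L2w_continuous_rV_box (M := M)) => //; first exact: test_continuous tphi.
by move=> x xM; apply: test_eq0 => /hM.
Qed.

Lemma test_L2v D phi : measurable D -> test_function Omega phi ->
  L2v D (grad phi).
Proof.
move=> mD tphi i; have [M hM] := test_supp_box tphi.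
rewrite (_ : (fun _ => _) = partial i phi); last first.
  by apply/funext => x; rewrite mxE.
apply: (L2w_continuous_rV_box (M := M)) => //.
  exact: test_partial_continuous tphi.
by move=> x xM; apply: test_partial_eq0 => /hM.
Qed.

Lemma hardy_pointwise phi x : (3 <= N)%N ->
  (forall i, derivable phi x (delta_mx 0 i)) ->
  (N%:R - 2) / 2 * (rho x `^ (-1) * phi x) ^+ 2 -
    2 / (N%:R - 2) * dotv (grad phi x) (grad phi x) <=
  \sum_i partial i (hardy_field phi i) x.
Proof.
move=> N3 dphi; have m0 : 0 < N%:R - 2 :> R by rewrite subr_gt0 ltr_nat.
under eq_bigr do rewrite [partial _ _ _](@derive_val _ _ _ _ _ _ _
  (is_derive_hardy_field (dphi _))).
rewrite !big_split/= sumr_const card_ord sumrN -!mulr_sumr -!mulr_suml.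
rewrite powR_inv1 ?(ltW (rho_gt0 _))// exprMn (exprVn (rho x)) sqr_rho.
have -> : \sum_i x 0 i ^+ 2 = dotv x x by apply: eq_bigr => i _; rewrite expr2.
have -> : \sum_i x 0 i * partial i phi x = dotv x (grad phi x).
  by apply: eq_bigr => i _; rewrite mxE.
have CS : dotv x (grad phi x) ^+ 2 <= dotv x x * dotv (grad phi x) (grad phi x).
  have := si_CauchySchwarz (dotv_semi_inner R N) (I : setT x) (I : setT (grad phi x)).
  rewrite -sqrtrM ?dotv_ge0// => /(lerXn2r 2).
  rewrite !nnegrE normr_ge0 sqrtr_ge0 real_normK ?num_real//.
  by rewrite sqr_sqrtr ?mulr_ge0 ?dotv_ge0//; apply.
have q0 : 0 < 1 + dotv x x by rewrite ltr_wpDr ?dotv_ge0.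
have r1 : (1 + dotv x x) * (1 + dotv x x)^-1 = 1 by rewrite mulfV// gt_eqF.
have r0 : 0 < (1 + dotv x x)^-1 by rewrite invr_gt0.
move: (dotv_ge0 x) (dotv_ge0 (grad phi x)) CS r1 r0.
move: (phi x) (dotv (grad phi x) _) (dotv x (grad phi x)) => p g S.
set r := (1 + dotv x x)^-1; move: r => r; move: (dotv x x) => d.
set m := N%:R - 2 in m0 *; move=> d0 g0 CS r1 r0.
(* Cauchy-Schwarz gives [S^2 <= d g], and [r d = 1 - r] is at most [1]. *)
have rS : r * S ^+ 2 <= g.
  apply: le_trans (ler_wpM2l (ltW r0) CS) _.
  by rewrite mulrA ler_piMl//; lra.
rewrite -subr_ge0.
have {}rS : 0 <= 2 / m * (g - r * S ^+ 2).
  by rewrite mulr_ge0 ?subr_ge0// divr_ge0// ltW.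
have sq : 0 <= r * (2 / m * (m / 2 * p + S) ^+ 2).
  by apply: mulr_ge0 (ltW r0) (mulr_ge0 _ (sqr_ge0 _)); rewrite divr_ge0// ltW.
have rp : 0 <= 2 * (r * p) ^+ 2 by rewrite mulr_ge0// sqr_ge0.
(* Completing the square in [S]: with [d r = 1 - r], the divergence is
   [m r p^2 + 2 r^2 p^2 + 2 r p S], and its excess over the claimed bound is a sum of three
   nonnegative terms. *)
rewrite [leRHS](_ : _ = 2 / m * (g - r * S ^+ 2) + r * (2 / m * (m / 2 * p + S) ^+ 2)
   + 2 * (r * p) ^+ 2); first by rewrite !addr_ge0.
have Nm : N%:R = m + 2 by rewrite /m subrK.
have dr : d * r = 1 - r by rewrite -r1; ring.
rewrite -[_ *+ N]mulr_natl Nm.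
have -> : d * r ^+ 2 * p ^+ 2 = (d * r) * r * p ^+ 2 by ring.
by rewrite dr; field; rewrite gt_eqF.
Qed.

End test_functions.

Section hardy.
Context (R : realType) (N : nat) (Omega : set 'rV[R]_N).
Local Notation E := 'rV[R]_N.
Local Notation mu := (lebesgue_rV R N).
Implicit Types (phi : E -> R) (D : set E).

(** Integrating [hardy_pointwise] kills the divergence and leaves [m/2] times the squared weighted
    norm at most [2/m] times the squared gradient norm, with [m = N - 2]; hence the constant
    [2/m]. *)
Lemma hardy_inequality phi : (3 <= N)%N -> measurable Omega ->
  test_function Omega phi ->
  L2w_norm (-1) Omega phi <= 2 / (N%:R - 2) * L2v_norm Omega (grad phi).
Proof.
move=> N3 mO tphi; have m0 : 0 < N%:R - 2 :> R by rewrite subr_gt0 ltr_nat.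
have [M hM] := test_supp_box tphi.
have phiO x : ~ Omega x -> ~ supp phi x by case: tphi => _ _ h xO /h.
(* As the support of [phi] lies in [Omega], all integrals may be taken over the whole space, where
   partial derivatives integrate to zero. *)
have RE (h : E -> R) : (forall x, ~ supp phi x -> h x = 0) ->
    \int[mu]_(x in Omega) h x = \int[mu]_x h x.
  move=> h0; rewrite Rintegral_mkcond; apply: eq_Rintegral => x _.
  rewrite patchE; case: ifPn => // /negP; rewrite inE => xO.
  by rewrite h0//; exact: phiO.
have gradE x : ~ supp phi x -> dotv (grad phi x) (grad phi x) = 0.
  move=> xphi; rewrite /dotv big1// => i _.
  by rewrite mxE (test_partial_eq0 _ xphi) mul0r.
rewrite /L2w_norm /L2v_norm /L2v_dot RE; last first.
  by move=> x xphi; rewrite (test_eq0 xphi) mulr0 expr0n.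
rewrite RE//.
have iP := proj2 (test_L2w (s := -1) (@measurableT _ E) (lerN10 R) tphi).
have LG := test_L2v (@measurableT _ E) tphi.
have iG := L2v_dot_integrable (@measurableT _ E) LG LG.
have cF i : continuous (hardy_field phi i).
  exact: continuous_hardy_field (test_continuous tphi).
have cdF i : continuous (partial i (hardy_field phi i)).
  apply: continuous_partial_hardy_field.
  - exact: test_continuous tphi.
  - by move=> x; exact: test_derivable tphi.
  - exact: test_partial_continuous tphi.
have FM i x : ~ rV_box M x -> hardy_field phi i x = 0.
  move=> xM; have x0 : phi x = 0 by apply: test_eq0 => /hM.
  by rewrite /hardy_field x0 expr0n mulr0.
have iF i : mu.-integrable setT (EFin \o partial i (hardy_field phi i)).
  apply: (continuous_rV_box_integrableT (M := M)) => //.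
  exact: (partial_eq0 i (@rV_box_closed R N M) (FM i)).
have F0 i : (\int[mu]_x (partial i (hardy_field phi i) x)%:E = 0)%E.
  have dF x : derivable (hardy_field phi i) x (delta_mx 0 i).
    have dx := is_derive_hardy_field (test_derivable (i := i) (x := x) tphi).
    exact: ex_derive.
  exact: (integral_partial_eq0 (cF i) dF (cdF i) (FM i)).
have iS : mu.-integrable setT
    (EFin \o (fun x => \sum_i partial i (hardy_field phi i) x)).
  rewrite /comp; under eq_fun do rewrite -sumEFin.
  by apply: integrable_sum => // i _; exact: iF.
have S0 : \int[mu]_x (\sum_i partial i (hardy_field phi i) x) = 0.
  rewrite /Rintegral; under eq_integral do rewrite -sumEFin.
  by rewrite integral_sum// big1.
have i1 := integrableZl measurableT ((N%:R - 2) / 2) iP.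
have i2 := integrableZl measurableT (2 / (N%:R - 2)) iG.
have : \int[mu]_x ((N%:R - 2) / 2 * (rho x `^ (-1) * phi x) ^+ 2 -
    2 / (N%:R - 2) * dotv (grad phi x) (grad phi x)) <= 0.
  rewrite -S0; apply: le_Rintegral => //; first exact: (integrableB _ i1 i2).
  by move=> x _; apply: hardy_pointwise => // i; exact: test_derivable tphi.
rewrite RintegralB// !RintegralZl// subr_le0 => h.
have k0 : 0 <= 2 / (N%:R - 2) :> R by rewrite divr_ge0// ltW.
rewrite -[leRHS]ger0_norm ?(mulr_ge0 k0) ?sqrtr_ge0//.
rewrite -[leRHS]sqrtr_sqr; apply: ler_wsqrtr.
rewrite exprMn sqr_sqrtr; last by apply: Rintegral_ge0 => x _; exact: dotv_ge0.
have c0 : 0 < (N%:R - 2) / 2 :> R by rewrite divr_gt0.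
rewrite -(ler_pM2l c0); apply: le_trans h _.
rewrite le_eqVlt; apply/orP; left; apply/eqP; field.
by rewrite gt_eqF.
Qed.

End hardy.

(** * Density of test functions *)

Lemma ler_epsM (R : realType) (x y k : R) : 0 <= k ->
  (forall e, 0 < e -> x <= y + k * e) -> x <= y.
Proof.
move=> k0 h; apply/ler_addgt0Pr => e e0.
have k1 : 0 < 1 + k by rewrite ltr_pwDl.
apply: le_trans (h _ (divr_gt0 e0 k1)) _; rewrite lerD2l.
by rewrite mulrCA ger_pMr// ler_pdivrMr// mul1r lerDr.
Qed.

Section density.
Context (R : realType) (N : nat) (Omega : set 'rV[R]_N).
Hypotheses (mO : measurable Omega) (N_ge3 : (3 <= N)%N).
Local Notation E := 'rV[R]_N.
Implicit Types (phi psi u f : E -> R) (v w : E -> E) (U W : (E -> R) * (E -> E)).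

Lemma iter_partialB phi psi s : smooth phi -> smooth psi ->
  iter_partial s (phi \- psi) = iter_partial s phi \- iter_partial s psi.
Proof.
move=> sphi spsi; elim: s => //= i s ->; apply/funext => x.
by rewrite /partial deriveB//; [exact: (sphi s).2|exact: (spsi s).2].
Qed.

Lemma test_functionB phi psi : test_function Omega phi ->
  test_function Omega psi -> test_function Omega (phi \- psi).
Proof.
move=> tphi tpsi; case: (tphi) (tpsi) => sphi cphi Ophi [spsi cpsi Opsi].
have sub : supp (phi \- psi) `<=` supp phi `|` supp psi.
  rewrite /supp -closureU; apply: closure_subset => x /=.
  apply: contra_neqP => /not_orP[/negP/negPn/eqP -> /negP/negPn/eqP ->].
  by rewrite subrr.
split.
- move=> s; rewrite iter_partialB//; split => [x|i x].
    by apply: continuousB; [exact: (sphi s).1|exact: (spsi s).1].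
  by apply: derivableB; [exact: (sphi s).2|exact: (spsi s).2].
- apply: (subclosed_compact _ _ sub); first exact: closed_closure.
  exact: compactU.
- by move=> x /sub[/Ophi|/Opsi].
Qed.

Lemma gradB phi psi : test_function Omega phi -> test_function Omega psi ->
  grad (phi \- psi) = grad phi \- grad psi.
Proof.
move=> tphi tpsi; apply/funext => x; apply/rowP => i; rewrite !mxE.
rewrite /partial deriveB//; first exact: test_derivable tphi.
exact: test_derivable tpsi.
Qed.

Lemma L2w_normB s u f : L2w s Omega u -> L2w s Omega f ->
  L2w_norm s Omega (u \- f) <= L2w_norm s Omega u + L2w_norm s Omega f.
Proof.
by move=> Lu Lf; rewrite !L2w_normE; exact: (si_sqrtB (L2w_semi_inner mO s)).
Qed.

Lemma L2v_normB v w : L2v Omega v -> L2v Omega w ->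
  L2v_norm Omega (v \- w) <= L2v_norm Omega v + L2v_norm Omega w.
Proof. by move=> Lv Lw; exact: (si_sqrtB (L2v_semi_inner mO)). Qed.

(* Membership in H1w0, without the redundant weak differentiability. *)
Definition test_limit U := [/\ L2w (-1) Omega U.1, L2v Omega U.2 &
  forall e : R, 0 < e -> exists phi, [/\ test_function Omega phi,
    L2w_norm (-1) Omega (U.1 \- phi) <= e & L2v_norm Omega (U.2 \- grad phi) <= e]].

Lemma H1w0_test_limit U : H1w0 Omega U -> test_limit U.
Proof.
case=> [[Lu Ldu _] h]; split => // e /h[phi tphi phie]; exists phi; split => //.
  apply: le_trans (ltW phie); rewrite /H1w_norm/=.
  by rewrite -[leLHS]ger0_norm ?sqrtr_ge0// -sqrtr_sqr ler_wsqrtr// lerDl sqr_ge0.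
apply: le_trans (ltW phie); rewrite /H1w_norm/=.
by rewrite -[leLHS]ger0_norm ?sqrtr_ge0// -sqrtr_sqr ler_wsqrtr// lerDr sqr_ge0.
Qed.

(** Needed to test with [uhat - u], the difference of two members of the affine space. *)
Lemma test_limitB U W : test_limit U -> test_limit W ->
  test_limit (U.1 \- W.1, U.2 \- W.2).
Proof.
move=> [LU LdU hU] [LW LdW hW]; split.
- exact: (si_memB (L2w_semi_inner mO (-1))).
- exact: (si_memB (L2v_semi_inner mO)).
move=> e e0; have e20 : 0 < e / 2 by rewrite divr_gt0.
have [phi [tphi p1 p2]] := hU _ e20; have [psi [tpsi q1 q2]] := hW _ e20.
exists (phi \- psi); split => /=; first exact: test_functionB.
- rewrite (_ : _ \- _ = (U.1 \- phi) \- (W.1 \- psi)).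
    rewrite [leRHS]splitr; apply: le_trans (lerD p1 q1); apply: L2w_normB.
      by apply: (si_memB (L2w_semi_inner mO (-1))) => //; exact: test_L2w tphi.
    by apply: (si_memB (L2w_semi_inner mO (-1))) => //; exact: test_L2w tpsi.
  by apply/funext => x /=; rewrite !opprB addrACA [RHS]addrACA [in LHS](addrC (- _)).
- rewrite gradB// (_ : _ \- _ = (U.2 \- grad phi) \- (W.2 \- grad psi)).
    rewrite [leRHS]splitr; apply: le_trans (lerD p2 q2); apply: L2v_normB.
      by apply: (si_memB (L2v_semi_inner mO)) => //; exact: test_L2v tphi.
    by apply: (si_memB (L2v_semi_inner mO)) => //; exact: test_L2v tpsi.
  by apply/funext => x /=; rewrite !opprB addrACA [RHS]addrACA [in LHS](addrC (- _)).
Qed.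

(** Hardy's inequality passes to the limit: an approximation within [e] costs [e] on the left and
    [2 / (N - 2) * e] through the gradient. *)
Lemma poincare_inequality U : test_limit U ->
  L2w_norm (-1) Omega U.1 <= 2 / (N%:R - 2) * L2v_norm Omega U.2.
Proof.
case=> LU LdU h; have k0 : 0 <= 2 / (N%:R - 2) :> R.
  by rewrite divr_ge0// subr_ge0 ler_nat ltnW.
apply: (@ler_epsM _ _ _ (1 + 2 / (N%:R - 2))); first by rewrite addr_ge0.
move=> e /h[phi [tphi p1 p2]].
have Lphi : L2w (-1) Omega phi by exact: test_L2w tphi.
have Lgphi : L2v Omega (grad phi) by exact: test_L2v tphi.
have Lp := si_memB (L2w_semi_inner mO (-1)) LU Lphi.
have Lgp := si_memB (L2v_semi_inner mO) LdU Lgphi.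
have := si_sqrtD (L2w_semi_inner mO (-1)) Lp Lphi.
rewrite subrK => /le_trans; apply.
have h1 := hardy_inequality N_ge3 mO tphi.
have h2 : L2v_norm Omega (grad phi) <=
    L2v_norm Omega U.2 + L2v_norm Omega (U.2 \- grad phi).
  by have := L2v_normB LdU Lgp; rewrite -[_ \- _]/(U.2 - (U.2 - grad phi)) subKr.
have h3 := le_trans h1 (ler_wpM2l k0 (le_trans h2 (lerD (lexx _) p2))).
apply: le_trans (lerD p1 h3) _.
by rewrite le_eqVlt; apply/orP; left; apply/eqP; ring.
Qed.

(** Integration by parts extends from test functions to their limits because both pairings are
    continuous, the first in the gradient and the second in the weighted norm. *)
Lemma weak_divergence_test_limit v f U : Hdiv Omega (v, f) -> test_limit U ->
  L2v_dot Omega v U.2 = - L2_dot Omega f U.1.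
Proof.
case=> /= Lv Lf vf [LU LdU h]; apply/eqP; rewrite -subr_eq0 opprK -normr_le0.
apply: (@ler_epsM _ _ _ (L2v_norm Omega v + L2w_norm 1 Omega f)).
  by rewrite addr_ge0// sqrtr_ge0.
move=> e /h[phi [tphi p1 p2]].
have Lphi : L2w (-1) Omega phi by exact: test_L2w tphi.
have Lgphi : L2v Omega (grad phi) by exact: test_L2v tphi.
have Lp := si_memB (L2w_semi_inner mO (-1)) LU Lphi.
have Lgp := si_memB (L2v_semi_inner mO) LdU Lgphi.
have -> : L2v_dot Omega v U.2 + L2_dot Omega f U.1 =
    L2v_dot Omega v (U.2 - grad phi) + L2_dot Omega f (U.1 \- phi).
  rewrite (siBr (L2v_semi_inner mO))// L2_dotBr// (vf _ tphi); lra.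
rewrite add0r mulrDl (le_trans (ler_normD _ _))// lerD//.
  apply: le_trans (si_CauchySchwarz (L2v_semi_inner mO) Lv Lgp) _.
  by rewrite ler_wpM2l// sqrtr_ge0.
by apply: le_trans (L2_dot_le mO Lf Lp) _; rewrite ler_wpM2l// sqrtr_ge0.
Qed.

End density.

(** * The two-sided estimate *)

Section ereal_bounds.
Context (R : realType) (I J : Type) (P : set I) (Q : set J).
Context (a : I -> R) (b : J -> R) (x : R).
Local Open Scope ereal_scope.

Lemma le_ereal_infD : P !=set0 -> Q !=set0 ->
  (forall i j, P i -> Q j -> (x <= a i + b j)%R) ->
  x%:E <= ereal_inf [set (a i)%:E | i in P] + ereal_inf [set (b j)%:E | j in Q].
Proof.
move=> [i0 Pi0] [j0 Qj0] h.
have lb j : Q j -> (x - b j)%:E <= ereal_inf [set (a i)%:E | i in P].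
  move=> Qj; apply: le_ereal_inf_tmp => _ [i Pi <-].
  by rewrite lee_fin lerBlDr h.
have : ereal_inf [set (a i)%:E | i in P] <= (a i0)%:E.
  by apply: ereal_inf_lbound; exists i0.
(* A point of [P] excludes [+oo] and a point of [Q] excludes [-oo], so the first infimum is a real
   [s] and [x - s] is a lower bound for the second. *)
move: lb; case: (ereal_inf [set (a i)%:E | i in P]) => [s| |] lb ub.
- rewrite -leeBlDl//; apply: le_ereal_inf_tmp => _ [j Qj <-].
  by have := lb j Qj; rewrite !lee_fin !lerBlDr addrC.
- by move: ub; rewrite leye_eq.
- by have := lb _ Qj0; rewrite leeNy_eq.
Qed.

End ereal_bounds.

(** The second summand stays extended because it will be a double supremum. A point of [P] rules out
    [t = +oo], and for [t = -oo] the sum is [-oo]. *)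
Lemma ge_ereal_supD (R : realType) (I : Type) (P : set I) (a : I -> R)
    (t : \bar R) (x : R) :
  P !=set0 -> (forall i, P i -> ((a i)%:E + t <= x%:E)%E) ->
  (ereal_sup [set (a i)%:E | i in P] + t <= x%:E)%E.
Proof.
move=> [i0 Pi0]; case: t => [t| |] h.
- rewrite -leeBrDr//; apply: ge_ereal_sup => _ [i Pi <-].
  by rewrite leeBrDr// h.
- by have := h _ Pi0; rewrite addey// leye_eq.
- by rewrite addeNy leNye.
Qed.

Lemma L2_dot0l (R : realType) (N : nat) (Omega : set 'rV[R]_N)
  (u : 'rV[R]_N -> R) : measurable Omega -> L2_dot Omega (cst 0) u = 0.
Proof.
move=> mO; rewrite /L2_dot (eq_Rintegral _ (g := cst 0)) => [|x _].
  by rewrite Rintegral_cst// mul0r.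
by rewrite mul0r.
Qed.

Section two_sided_estimate.
Context (R : realType) (N : nat) (Omega : set 'rV[R]_N)
  (A : 'rV[R]_N -> 'M[R]_N) (alpha : R) (f : 'rV[R]_N -> R)
  (U0 Uhat : ('rV[R]_N -> R) * ('rV[R]_N -> 'rV[R]_N))
  (tv : 'rV[R]_N -> 'rV[R]_N).
Hypotheses (N_ge3 : (3 <= N)%N) (mO : measurable Omega)
  (A_sym : forall x, Omega x -> (A x)^T = A x)
  (A_bnd : forall i j, Linfty Omega (fun x => A x i j))
  (alpha_gt0 : 0 < alpha)
  (A_ell : forall x, Omega x -> forall xi : 'rV[R]_N,
    alpha ^- 2 * enorm xi ^+ 2 <= dotv (mulMv (A x) xi) xi)
  (f_L2 : L2w 1 Omega f)
  (U0_H1 : H1w Omega U0)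
  (Uhat_sol : weak_solution Omega A f U0 Uhat)
  (tv_L2 : L2v Omega tv).
Local Notation E := 'rV[R]_N.
Local Notation invAv := (mapMv (invA A)).
Local Notation err := (Uhat.2 - invAv tv).

Let SA : semi_inner (L2v Omega) (L2A_dot Omega A).
Proof. exact: L2A_semi_inner mO A_sym A_bnd alpha_gt0 A_ell. Qed.

Let S : semi_inner (L2v Omega) (L2v_dot Omega).
Proof. exact: L2v_semi_inner. Qed.

Let L2_invA v : L2v Omega v -> L2v Omega (invAv v).
Proof. exact: L2v_mapinvA mO A_bnd alpha_gt0 A_ell v. Qed.

Let dot_invA v w : L2A_dot Omega A (invAv v) w = L2v_dot Omega v w.
Proof. exact: L2A_dot_invA alpha_gt0 A_ell v w. Qed.

(** Shows that the first infimum in [Mcal_plus] ranges over a nonempty set. *)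
Let Hdiv00 : Hdiv Omega (0, cst 0).
Proof.
split; first by case: S.
  by case: (L2w_semi_inner mO 1).
by move=> phi tphi; rewrite L2_dot0l// oppr0; exact: (si0l S (test_L2v mO tphi)).
Qed.

Let Uhat_L2 : L2v Omega Uhat.2.
Proof.
case: Uhat_sol => [[W /H1w0_test_limit[_ LW _] <-] _]; case: U0_H1 => _ L0 _.
exact: (si_memD S).
Qed.

Let err_L2 : L2v Omega err.
Proof. by apply: (si_memB S) => //; exact: L2_invA. Qed.

Lemma L2A_dot_Uhat W : H1w0 Omega W ->
  L2A_dot Omega A Uhat.2 W.2 = L2_dot Omega f W.1.
Proof. by case: Uhat_sol => _; exact. Qed.

(** The boundary datum cancels in [uhat - u]. Its two summands lie in [H1w0], so the weak equation
    is applied to each and subtracted. *)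
Lemma H1w0_plus_diff U : H1w0_plus Omega U0 U -> exists2 W,
  test_limit Omega W & W.2 = Uhat.2 - U.2 /\
    L2A_dot Omega A Uhat.2 W.2 = L2_dot Omega f W.1.
Proof.
case: (Uhat_sol) => [[W1 HW1 UW1] _] [W2 HW2 <-].
have [L1 L1' h1] := H1w0_test_limit HW1; have [L2 L2' h2] := H1w0_test_limit HW2.
exists (W1.1 \- W2.1, W1.2 \- W2.2) => /=.
  by apply: test_limitB => //; exact: H1w0_test_limit.
split.
  rewrite -UW1 /=; apply/funext => x.
  by rewrite -[RHS]/(W1.2 x + U0.2 x - (W2.2 x + U0.2 x)) opprD addrACA subrr addr0.
by rewrite L2_dotBr// -!L2A_dot_Uhat// -(siBr SA).
Qed.

Lemma L2A_dot_err_le V W : Hdiv Omega V -> test_limit Omega W ->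
  L2A_dot Omega A Uhat.2 W.2 = L2_dot Omega f W.1 ->
  L2A_dot Omega A err W.2 <=
    M_plus Omega A alpha f tv V * L2A_norm Omega A W.2.
Proof.
move=> HV TW fW; have [LV LdV _] := HV; have [LW LdW _] := TW.
have Ltv : L2v Omega (tv - V.1) by exact: (si_memB S).
(* The weak equation turns the [uhat] term into [f]; integration by parts then adds [div v] to [f]
   and subtracts [v] from [tv]. *)
have -> : L2A_dot Omega A err W.2 = L2_dot Omega (f \+ V.2) W.1 -
    L2A_dot Omega A (invAv (tv - V.1)) W.2.
  rewrite (siBl SA)//; last exact: L2_invA.
  rewrite fW !dot_invA (siBl S)// L2_dotDl//.
  have HV' : Hdiv Omega (V.1, V.2) by case: (V) HV.
  by rewrite (weak_divergence_test_limit mO HV' TW); ring.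
rewrite /M_plus mulrDl; apply: lerD; last first.
  have := si_CauchySchwarz SA (L2_invA Ltv) LdW.
  by apply: le_trans; rewrite -normrN ler_norm.
apply: le_trans (ler_norm _) _.
have LfV : L2w 1 Omega (f \+ V.2) by exact: (si_memD (L2w_semi_inner mO 1)).
apply: le_trans (L2_dot_le mO LfV LW) _.
rewrite [leRHS]mulrAC [leLHS]mulrC; apply: ler_wpM2r; first exact: sqrtr_ge0.
(* Poincare contributes [2 / (N - 2)] and ellipticity [alpha]; their product is [poincare_cst]. *)
apply: le_trans (poincare_inequality mO N_ge3 TW) _.
have h := L2v_norm_le_L2A_norm mO A_bnd alpha_gt0 A_ell LdW.
rewrite /poincare_cst [2 * alpha]mulrC -!mulrA mulrCA.
rewrite ler_wpM2l// mulrCA ler_wpM2l// invr_ge0 subr_ge0 ler_nat.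
exact: ltnW.
Qed.

Lemma upper_bound V U : Hdiv Omega V -> H1w0_plus Omega U0 U ->
  L2A_norm Omega A err ^+ 2 <=
  M_plus Omega A alpha f tv V ^+ 2 + Mt_plus Omega A tv U.2 ^+ 2.
Proof.
move=> HV /H1w0_plus_diff[W TW [WE fW]]; have [LW LdW _] := TW.
have := si_le_sqrD SA err_L2 LdW (L2A_dot_err_le HV TW fW).
(* Since [W.2] is the gradient of [uhat - u], the unknown solution cancels. *)
have -> : err - W.2 = U.2 - invAv tv.
  by rewrite WE opprB addrC addrA subrK.
rewrite /Mt_plus /L2A_norm !sqr_sqrtr//; apply: (si_ge0 SA) => //.
by apply: (si_memB S) => //; [|exact: L2_invA]; rewrite -[U.2](subKr Uhat.2) -WE;
  exact: (si_memB S).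
Qed.

Lemma lower_bound W U v : H1w0 Omega W -> H1w0_plus Omega U0 U ->
  Hdiv0 Omega v ->
  M_minus Omega A f tv W + Mt_minus Omega A tv v U.2 <= L2A_norm Omega A err ^+ 2.
Proof.
move=> HW /H1w0_plus_diff[D TD [DE _]] Hv.
have TW := H1w0_test_limit HW.
have [_ LW _] := TW; have [_ LD _] := TD; have [Lv _ _] := Hv.
have Lq := L2_invA Lv; have Lt := L2_invA tv_L2.
have v0 T : test_limit Omega T -> L2v_dot Omega v T.2 = 0.
  by move=> TT; rewrite (weak_divergence_test_limit mO Hv TT) L2_dot0l ?oppr0.
have LU : L2v Omega U.2.
  by rewrite -[U.2](subKr Uhat.2) -DE; exact: (si_memB S).
rewrite /L2A_norm sqr_sqrtr ?(si_ge0 SA)//.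
(* Applied with [p] the gradient of [W] and [q = A^-1 v]; they are orthogonal in energy because [v]
   has zero divergence. *)
apply: le_trans (si_ge_orthogonal SA err_L2 LW Lq _); last first.
  by rewrite (siC SA)// dot_invA v0.
apply: lerD.
  rewrite /M_minus -[_ \+ _]/(W.2 + 2 *: invAv tv).
  rewrite (siDl SA)//; last exact: (si_memZ S).
  by rewrite (siZl SA)// (siBl SA)// L2A_dot_Uhat//; lra.
rewrite /Mt_minus.
(* Writing the gradient of [u] as that of [uhat] minus [D.2] exposes [err]; the [D.2] term is then
   orthogonal to [A^-1 v], which leaves [2 <err, q> - <q, q>]. *)
have -> : 2 \*: U.2 \- mapMv (invA A) (2 \*: tv \+ v) =
    2 *: (err - D.2) - invAv v.
  rewrite DE; apply/funext => x.
  rewrite -[LHS]/(2 *: U.2 x - mulMv (invA A x) (2 *: tv x + v x)).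
  rewrite -[RHS]/(2 *: (Uhat.2 x - mulMv (invA A x) (tv x) - (Uhat.2 x - U.2 x))
    - mulMv (invA A x) (v x)).
  rewrite /mulMv mulmxDl -scalemxAl opprD addrA -scalerBr; congr (_ *: _ - _).
  by rewrite opprB [RHS]addrC addrA subrK.
have Led := si_memB S err_L2 LD.
rewrite (siBl SA)//; last exact: (si_memZ S).
rewrite (siZl SA)// (siBl SA)// (siC SA LD Lq) dot_invA (v0 _ TD).
by rewrite subr0.
Qed.

Lemma M_plus_le_young V beta : 0 < beta ->
  M_plus Omega A alpha f tv V ^+ 2 <= M_plus_young Omega A alpha f tv V beta.
Proof.
rewrite /M_plus /M_plus_young => b0.
set c := poincare_cst _ _; move: (L2w_norm _ _ _) (L2A_norm _ _ _) => x y.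
have := sqr_ge0 (c * x - beta * y) => h.
rewrite -subr_ge0.
(* The gap in Young's inequality is exactly this weighted square. *)
rewrite [leRHS](_ : _ = beta^-1 * (c * x - beta * y) ^+ 2).
  by rewrite mulr_ge0// invr_ge0 ltW.
by field; rewrite gt_eqF.
Qed.

Lemma Mcal_plus_ge :
  ((L2A_norm Omega A err ^+ 2)%:E <= Mcal_plus Omega A alpha f U0 tv)%E.
Proof.
apply: le_ereal_infD; [by exists (0, cst 0)|by exists Uhat; case: Uhat_sol|].
by move=> V U HV HU; exact: upper_bound.
Qed.

Lemma Mcal_minus_le :
  (Mcal_minus Omega A f U0 tv <= (L2A_norm Omega A err ^+ 2)%:E)%E.
Proof.
case: (Uhat_sol) => [[W0 HW0 _] _].
apply: ge_ereal_supD => [|W HW]; first by exists W0.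
(* For fixed [W] the first summand is real, so it moves to the other side and the double supremum is
   bounded termwise. *)
rewrite -leeBrDl//; apply: ge_ereal_sup => _ [U HU <-].
apply: ge_ereal_sup => _ [v Hv <-].
by rewrite -EFinB lee_fin lerBrDl lower_bound.
Qed.

End two_sided_estimate.

Theorem theorem4 (R : realType) (N : nat) (Omega : set 'rV[R]_N)
    (A : 'rV[R]_N -> 'M[R]_N) (alpha : R) (f : 'rV[R]_N -> R)
    (u0 uhat : 'rV[R]_N -> R) (du0 duhat : 'rV[R]_N -> 'rV[R]_N)
    (tv : 'rV[R]_N -> 'rV[R]_N)
    (N_ge3 : (3 <= N)%N)
    (Omega_ext : exterior_domain Omega)
    (Omega_lip : lipschitz_boundary Omega)
    (A_sym : forall x, Omega x -> (A x)^T = A x)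
    (A_bnd : forall i j, Linfty Omega (fun x => A x i j))
    (alpha_gt0 : 0 < alpha)
    (A_ell : forall x, Omega x -> forall xi : 'rV[R]_N,
      alpha ^- 2 * enorm xi ^+ 2 <= dotv (mulMv (A x) xi) xi)
    (f_L2 : L2w 1 Omega f)
    (u0_H1 : H1w Omega (u0, du0))
    (uhat_sol : weak_solution Omega A f (u0, du0) (uhat, duhat))
    (tv_L2 : L2v Omega tv) :
  let err2 := L2A_norm Omega A (duhat \- mapMv (invA A) tv) ^+ 2 in
  [/\ (err2%:E <= Mcal_plus Omega A alpha f (u0, du0) tv)%E,
      (Mcal_minus Omega A f (u0, du0) tv <= err2%:E)%E &
      forall V, Hdiv Omega V ->
        ((M_plus Omega A alpha f tv V ^+ 2)%R%:E <=
         ereal_inf [set (M_plus_young Omega A alpha f tv V beta)%:E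
                   | beta in [set beta : R | (0 < beta)%R]])%E].
Proof.
have mO : measurable Omega by case: Omega_ext => oO _ _; exact: open_measurable_rV.
split.
- exact: (Mcal_plus_ge N_ge3 mO A_sym A_bnd alpha_gt0 A_ell f_L2 u0_H1 uhat_sol).
- exact: (Mcal_minus_le mO A_sym A_bnd alpha_gt0 A_ell f_L2 u0_H1 uhat_sol).
- move=> V HV; apply: le_ereal_inf_tmp => _ [beta /= beta0 <-].
  by rewrite lee_fin M_plus_le_young.
Qed.
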